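(* For every $t\in(-1,1)\smallsetminus\{0\}$, the set $\mathrm{Hom}(\Gamma_{22},\mathrm{Isom}(\mathbb A\mathrm d\mathbb S^4))$ is a smooth $11$-dimensional manifold near $\rho_t$.
   Context: Let $q_{-1}(x)=-x_0^2+x_1^2+x_2^2+x_3^2-x_4^2$ on $\mathbb R^5$ with bilinear form $b_{-1}$; $\mathbb A\mathrm d\mathbb S^4=\{q_{-1}=-1\}$ and $\mathrm{Isom}(\mathbb A\mathrm d\mathbb S^4)=\mathrm O(q_{-1})$. For $q_{-1}(X)=\pm1$, $r_X\in\mathrm O(q_{-1})$ is the reflection equal to $-1$ on $X$ and to the identity on the $b_{-1}$-orthogonal of $X$. For $\varepsilon\in\{\pm1\}^3$ put $\sigma(\varepsilon)=\varepsilon_1\varepsilon_2\varepsilon_3$. $\Gamma_{22}$ is the right-angled Coxeter group with $22$ generators $p_\varepsilon,m_\varepsilon$ ($\varepsilon\in\{\pm1\}^3$), $\ell_{k,s}$ ($k\in\{1,2,3\}$, $s\in\{\pm1\}$), each of order two, with commutation relations: $p_\varepsilon$ and $m_\delta$ commute whenever $\varepsilon,\delta$ differ in at most one coordinate; $p_\varepsilon$ and $m_\varepsilon$ commute with $\ell_{k,s}$ whenever $\varepsilon_k=s$. For $t\in(-1,1)$, $\rho_t:\Gamma_{22}\to\mathrm O(q_{-1})$ is the representation sending each generator $g$ to $r_{f_t(g)}$, where $f_t(p_\varepsilon)=(1-t^2)^{-1/2}(\sqrt2t,t\varepsilon_1,t\varepsilon_2,t\varepsilon_3,\sigma(\varepsilon))$,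 $f_t(m_\varepsilon)=(1-t^2)^{-1/2}(\sqrt2,\varepsilon_1,\varepsilon_2,\varepsilon_3,t\sigma(\varepsilon))$, $f_t(\ell_{k,s})=e_0+s\sqrt2e_k$ ($e_0,\dots,e_4$ the standard basis). $\mathrm{Hom}(\Gamma_{22},\mathrm O(q_{-1}))$ is viewed as a subset of $\mathrm O(q_{-1})^{22}$ by evaluation on generators; ''smooth manifold near $\rho_t$'' means that some neighbourhood of $\rho_t$ in it is a smooth submanifold. *)

(* Defs.v *)
From HB Require Import structures.
From mathcomp Require Import all_boot all_order all_algebra.
From mathcomp Require Import generic_quotient ring.
From mathcomp Require Import all_classical all_reals all_analysis.
Import Order.TTheory GRing.Theory Num.Theory.
Import numFieldNormedType.Exports.

Set Implicit Arguments.
Unset Strict Implicit.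
Unset Printing Implicit Defensive.

Local Open Scope classical_set_scope.
Local Open Scope quotient_scope.
Local Open Scope ring_scope.

(** * Smooth submanifolds of Euclidean space *)

Fixpoint Ck_on (R : realType) (n m : nat) (k : nat) (U : set 'rV[R]_n)
    (f : 'rV[R]_n -> 'rV[R]_m) : Prop :=
  match k with
  | 0 => forall x, U x -> {for x, continuous f}
  | k'.+1 => (forall x, U x -> differentiable f x) /\
             (forall v : 'rV[R]_n, Ck_on k' U (fun x => 'D_v f x))
  end.

Definition smooth_on_open (R : realType) (n m : nat) (U : set 'rV[R]_n)
    (f : 'rV[R]_n -> 'rV[R]_m) : Prop :=
  forall k, Ck_on k U f.

(* Smoothness on an arbitrary subset of R^n: locally the restriction of a
   smooth map defined on an open subset of R^n. *)
Definition smooth_on (R : realType) (n m : nat) (X : set 'rV[R]_n)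
    (f : 'rV[R]_n -> 'rV[R]_m) : Prop :=
  forall x, X x -> exists (U : set 'rV[R]_n) (F : 'rV[R]_n -> 'rV[R]_m),
    [/\ open U, U x, smooth_on_open U F & forall y, (U `&` X) y -> F y = f y].

Definition diffeomorphic (R : realType) (n m : nat)
    (X : set 'rV[R]_n) (Y : set 'rV[R]_m) : Prop :=
  exists (f : 'rV[R]_n -> 'rV[R]_m) (g : 'rV[R]_m -> 'rV[R]_n),
    [/\ smooth_on X f, smooth_on Y g,
        forall x, X x -> Y (f x) /\ g (f x) = x
      & forall y, Y y -> X (g y) /\ f (g y) = y].

(* Embedded d-dimensional submanifold of R^n: a subset that is locally
   diffeomorphic to open subsets of R^d (Milnor, Guillemin-Pollack). *)
Definition submanifold (R : realType) (n d : nat) (S : set 'rV[R]_n) : Prop :=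
  forall x, S x -> exists (U : set 'rV[R]_n) (W : set 'rV[R]_d),
    [/\ open U, U x, open W & diffeomorphic (S `&` U) W].

Definition smooth_manifold_near (R : realType) (n d : nat) (S : set 'rV[R]_n)
    (p : 'rV[R]_n) : Prop :=
  S p /\ exists V : set 'rV[R]_n, [/\ open V, V p & submanifold d (S `&` V)].

(** * Groups given by generators and relators *)

(* Words in the generators and their formal inverses: the letter (i, false)
   is i and the letter (i, true) is the inverse of i. *)
Definition word (I : Type) := seq (I * bool).

Definition inv_word (I : Type) (w : word I) : word I :=
  rev [seq (l.1, ~~ l.2) | l <- w].

Inductive pres_eq (I : Type) (rels : word I -> Prop) : word I -> word I -> Prop :=
| pres_refl w : pres_eq rels w w
| pres_sym u v : pres_eq rels u v -> pres_eq rels v u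
| pres_trans u v w : pres_eq rels u v -> pres_eq rels v w -> pres_eq rels u w
| pres_cat u u' v v' : pres_eq rels u u' -> pres_eq rels v v' ->
    pres_eq rels (u ++ v) (u' ++ v')
| pres_cancel i b : pres_eq rels [:: (i, b); (i, ~~ b)] [::]
| pres_rel w : rels w -> pres_eq rels w [::].

Lemma pres_eqb_equiv (I : choiceType) (rels : word I -> Prop) :
  equiv_class_of (fun u v : word I => `[< pres_eq rels u v >]).
Proof.
split=> [u|u v|v u w].
- exact/asboolP/pres_refl.
- by apply/asboolP/asboolP; exact: pres_sym.
- move=> /asboolP uv /asboolP vw; exact/asboolP/(pres_trans uv vw).
Qed.

Definition pres_equiv (I : choiceType) (rels : word I -> Prop) :
    equiv_rel (word I) :=
  EquivRelPack (pres_eqb_equiv rels).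

Definition pres_group (I : choiceType) (rels : word I -> Prop) : Type :=
  {eq_quot (pres_equiv rels)}.

HB.instance Definition _ (I : choiceType) (rels : word I -> Prop) :=
  Choice.on (pres_group rels).

Definition pres_class (I : choiceType) (rels : word I -> Prop) (w : word I) :
    pres_group rels :=
  \pi_({eq_quot (pres_equiv rels)})%qT w.

Definition pres_gen (I : choiceType) (rels : word I -> Prop) (i : I) :
    pres_group rels :=
  pres_class rels [:: (i, false)].

Definition pres_one (I : choiceType) (rels : word I -> Prop) :
  pres_group rels := pres_class rels [::].

Definition pres_mul (I : choiceType) (rels : word I -> Prop)
  (x y : pres_group rels) : pres_group rels :=
  pres_class rels (repr x ++ repr y).

Definition pres_inv (I : choiceType) (rels : word I -> Prop)
  (x : pres_group rels) : pres_group rels :=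
  pres_class rels (inv_word (repr x)).

Lemma pres_classP (I : choiceType) (rels : word I -> Prop) (u v : word I) :
  pres_class rels u = pres_class rels v <-> pres_eq rels u v.
Proof.
split=> [/eqmodP/asboolP //|uv]; exact/eqmodP/asboolP.
Qed.

Lemma pres_reprK (I : choiceType) (rels : word I -> Prop)
  (x : pres_group rels) : pres_class rels (repr x) = x.
Proof. exact: reprK. Qed.

Lemma pres_repr_class (I : choiceType) (rels : word I -> Prop) (w : word I) :
  pres_eq rels (repr (pres_class rels w)) w.
Proof. by apply/pres_classP; rewrite pres_reprK. Qed.

Lemma pres_mulE (I : choiceType) (rels : word I -> Prop) (u v : word I) :
  pres_mul (pres_class rels u) (pres_class rels v) = pres_class rels (u ++ v).
Proof. by apply/pres_classP; apply: pres_cat; exact: pres_repr_class. Qed.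

Lemma inv_word_cat (I : Type) (u v : word I) :
  inv_word (u ++ v) = inv_word v ++ inv_word u.
Proof. by rewrite /inv_word map_cat rev_cat. Qed.

Lemma inv_wordK (I : Type) : involutive (@inv_word I).
Proof.
move=> w; rewrite /inv_word map_rev revK -map_comp -[RHS]map_id.
by apply: eq_map => -[i b] /=; rewrite negbK.
Qed.

Lemma pres_mulVw (I : Type) (rels : word I -> Prop) (w : word I) :
  pres_eq rels (inv_word w ++ w) [::].
Proof.
elim: w => [|[i b] w IH]; first exact: pres_refl.
rewrite -cat1s inv_word_cat -catA (catA (inv_word [:: (i, b)])).
apply: pres_trans IH; apply: pres_cat; first exact: pres_refl.
rewrite -[X in pres_eq _ _ X]cat0s; apply: pres_cat; last exact: pres_refl.
by rewrite /= -[X in [:: _; (i, X)]](negbK b); exact: pres_cancel.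
Qed.

Lemma pres_mulwV (I : Type) (rels : word I -> Prop) (w : word I) :
  pres_eq rels (w ++ inv_word w) [::].
Proof. by rewrite -{1}(inv_wordK w); exact: pres_mulVw. Qed.

Lemma pres_mulA (I : choiceType) (rels : word I -> Prop) :
  associative (@pres_mul I rels).
Proof.
move=> x y z; rewrite -(pres_reprK x) -(pres_reprK y) -(pres_reprK z).
by rewrite !pres_mulE catA.
Qed.

Lemma pres_mul1 (I : choiceType) (rels : word I -> Prop) :
  left_id (pres_one rels) (@pres_mul I rels).
Proof. by move=> x; rewrite -(pres_reprK x) pres_mulE. Qed.

Lemma pres_mulr1 (I : choiceType) (rels : word I -> Prop) :
  right_id (pres_one rels) (@pres_mul I rels).
Proof. by move=> x; rewrite -(pres_reprK x) pres_mulE cats0. Qed.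

Lemma pres_mulV (I : choiceType) (rels : word I -> Prop) :
  left_inverse (pres_one rels) (@pres_inv I rels) (@pres_mul I rels).
Proof.
move=> x; rewrite /pres_inv -{2}(pres_reprK x) pres_mulE.
exact/pres_classP/pres_mulVw.
Qed.

Lemma pres_mulrV (I : choiceType) (rels : word I -> Prop) :
  right_inverse (pres_one rels) (@pres_inv I rels) (@pres_mul I rels).
Proof.
move=> x; rewrite /pres_inv -{1}(pres_reprK x) pres_mulE.
exact/pres_classP/pres_mulwV.
Qed.

HB.instance Definition _ (I : choiceType) (rels : word I -> Prop) :=
  isGroup.Build (pres_group rels) (@pres_mulA I rels) (@pres_mul1 I rels)
    (@pres_mulr1 I rels) (@pres_mulV I rels) (@pres_mulrV I rels).

(* Relators of the right-angled Coxeter group with generators I in which i and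
   j commute whenever e i j. *)
Inductive racg_rels (I : Type) (e : I -> I -> bool) : word I -> Prop :=
| racg_invol i : racg_rels e [:: (i, false); (i, false)]
| racg_comm i j : e i j ->
    racg_rels e [:: (i, false); (j, false); (i, true); (j, true)].

Definition racg (I : choiceType) (e : rel I) := pres_group (racg_rels e).

(** * The group Gamma_22 *)

(* An element of {+1,-1} is encoded by a boolean b standing for (-1) ^+ b, and
   an index k in {1, 2, 3} by the ordinal of value k - 1. *)
Definition signs : predArgType := {ffun 'I_3 -> bool}.

Variant gen22 : predArgType :=
| gen_p of signs
| gen_m of signs
| gen_l of 'I_3 & bool.

Definition gen22_code (g : gen22) : signs + signs + 'I_3 * bool :=
  match g with
  | gen_p e => inl (inl e)
  | gen_m e => inl (inr e)
  | gen_l k s => inr (k, s)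
  end.

Definition gen22_decode (c : signs + signs + 'I_3 * bool) : gen22 :=
  match c with
  | inl (inl e) => gen_p e
  | inl (inr e) => gen_m e
  | inr (k, s) => gen_l k s
  end.

Lemma gen22_codeK : cancel gen22_code gen22_decode.
Proof. by case. Qed.

HB.instance Definition _ := Finite.copy gen22 (can_type gen22_codeK).

Lemma card_gen22 : #|gen22| = 22.
Proof.
have decodeK : cancel gen22_decode gen22_code by case=> [[]|[]].
rewrite (bij_eq_card (Bijective gen22_codeK decodeK)).
by rewrite !card_sum card_prod card_ffun !card_ord !card_bool.
Qed.

(* One orientation of each commuting pair suffices. *)
Definition commuting22 : rel gen22 := fun g h =>
  match g, h with
  | gen_p e, gen_m d => (#|[set k | e k != d k]%SET| <= 1)%N
  | gen_p e, gen_l k s | gen_m e, gen_l k s => e k == s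
  | _, _ => false
  end.

Definition Gamma22 := racg commuting22.

(** * The orthogonal group of AdS^4 and the representations rho_t *)

Definition b_AdS (R : realType) (x y : 'cV[R]_5) : R :=
  - (x 0 0 * y 0 0) + x 1 0 * y 1 0 + x 2 0 * y 2 0 + x 3 0 * y 3 0
  - x 4 0 * y 4 0.

Definition q_AdS (R : realType) (x : 'cV[R]_5) : R :=
  - x 0 0 ^+ 2 + x 1 0 ^+ 2 + x 2 0 ^+ 2 + x 3 0 ^+ 2 - x 4 0 ^+ 2.

(* Isom(AdS^4) = O(q_AdS), as matrices acting on column vectors. *)
Definition Isom_AdS (R : realType) : set 'M[R]_5 :=
  [set A | A \in unitmx /\ forall x, q_AdS (A *m x) = q_AdS x].

(* The matrix of v |-> v - 2 b(X,v)/q(X) X. *)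
Definition reflection (R : realType) (X : 'cV[R]_5) : 'M[R]_5 :=
  \matrix_(i, j)
    (let v := delta_mx j 0 in v - (2 * b_AdS X v / q_AdS X) *: X) i 0.


Lemma b_AdS_linear (R : realType) (X : 'cV[R]_5) :
  linear (b_AdS X : 'cV[R]_5 -> R^o).
Proof. by move=> a x y; rewrite /b_AdS !mxE /GRing.scale /=; ring. Qed.

Lemma reflectionE (R : realType) (X v : 'cV[R]_5) :
  reflection X *m v = v - (2 * b_AdS X v / q_AdS X) *: X.
Proof.
pose L := GRing.isLinear.Build _ _ _ _ (b_AdS X) (b_AdS_linear X).
pose bX : {linear 'cV[R]_5 -> R^o} := HB.pack (b_AdS X) L.
have bE : b_AdS X v = \sum_j b_AdS X (delta_mx j 0) * v j 0.
  rewrite -[LHS]/(bX v) {1}[v]matrix_sum_delta.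
  under eq_bigr do rewrite big_ord1.
  rewrite linear_sum; apply: eq_bigr => j _.
  by rewrite linearZ /= mulrC.
apply/matrixP => i k; rewrite (ord1 k) mxE.
under eq_bigr do rewrite !mxE mulrBl.
rewrite sumrB !mxE; congr (_ - _).
  rewrite (bigD1 i) //= big1 ?addr0 => [|j /negPf ji].
    by rewrite !eqxx mul1r.
  by rewrite eq_sym ji mul0r.
rewrite bE mulr_sumr !mulr_suml; apply: eq_bigr => j _.
ring.
Qed.

Lemma b_AdSxx (R : realType) (x : 'cV[R]_5) : b_AdS x x = q_AdS x.
Proof. by rewrite /b_AdS /q_AdS; ring. Qed.

Lemma reflectionP (R : realType) (X : 'cV[R]_5) (A : 'M[R]_5) :
  q_AdS X != 0 ->
  A = reflection X <->
  A *m X = - X /\ (forall v, b_AdS X v = 0 -> A *m v = v).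
Proof.
move=> qX; have rX : reflection X *m X = - X.
  rewrite reflectionE b_AdSxx -mulrA mulfV // mulr1 scaler_nat mulr2n.
  by rewrite opprD addrA subrr sub0r.
have rv v : b_AdS X v = 0 -> reflection X *m v = v.
  by move=> bv; rewrite reflectionE bv mulr0 mul0r scale0r subr0.
split=> [->|[AX Av]]; first by split.
apply/matrixP => i j.
have col_eq B C : B *m delta_mx j 0 = C *m delta_mx j 0 :> 'cV[R]_5 ->
    B i j = C i j.
  by rewrite -!colE => /matrixP/(_ i 0); rewrite !mxE.
apply: col_eq; set v := delta_mx j 0; pose c := b_AdS X v / q_AdS X.
have bw : b_AdS X (v - c *: X) = 0.
  rewrite addrC -scaleNr b_AdS_linear.
  by rewrite b_AdSxx /GRing.scale /= mulNr divfK ?addNr.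
rewrite -(subrK (c *: X) v) 2!(mulmxDr _ (v - c *: X)) -!scalemxAr AX rX.
by rewrite (Av _ bw) (rv _ bw).
Qed.

Definition sgn (R : realType) (b : bool) : R := (-1) ^+ b.

Definition sigma (R : realType) (e : signs) : R := \prod_k sgn R (e k).

Definition vec5 (R : realType) (x0 x1 x2 x3 x4 : R) : 'cV[R]_5 :=
  \col_i [:: x0; x1; x2; x3; x4]`_i.

Definition f_AdS (R : realType) (t : R) (g : gen22) : 'cV[R]_5 :=
  match g with
  | gen_p e => (Num.sqrt (1 - t ^+ 2))^-1 *:
      vec5 (Num.sqrt 2 * t) (t * sgn R (e 0)) (t * sgn R (e 1))
        (t * sgn R (e 2)) (sigma R e)
  | gen_m e => (Num.sqrt (1 - t ^+ 2))^-1 *: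
      vec5 (Num.sqrt 2) (sgn R (e 0)) (sgn R (e 1)) (sgn R (e 2))
        (t * sigma R e)
  | gen_l k s => delta_mx 0 0 + (sgn R s * Num.sqrt 2) *: delta_mx (inord k.+1) 0
  end.

(* The image of the generators under rho_t; these values determine rho_t. *)
Definition rho (R : realType) (t : R) (g : gen22) : 'M[R]_5 :=
  reflection (f_AdS t g).

(* Coordinates on the space of 22-tuples of 5 x 5 matrices: all the entries. *)
Definition coords (R : realType) (A : gen22 -> 'M[R]_5) :
    'rV[R]_#|{: gen22 * 'I_5 * 'I_5}| :=
  \row_k (let: (g, i, j) := enum_val k in A g i j).

Definition is_rep22 (R : realType) (phi : Gamma22 -> 'M[R]_5) : Prop :=
  (forall x, Isom_AdS (phi x)) /\
  (forall x y : Gamma22, phi (x * y)%g = phi x *m phi y).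

(* Hom(Gamma_22, Isom(AdS^4)) embedded by evaluation on the generators. *)
Definition Hom22 (R : realType) : set 'rV[R]_#|{: gen22 * 'I_5 * 'I_5}| :=
  [set coords (fun g => phi (pres_gen (racg_rels commuting22) g))
    | phi in [set phi | @is_rep22 R phi]].

(* Main.v *)
Require Import Defs.
From mathcomp Require Import all_boot all_order all_algebra.
From mathcomp Require Import ring lra.
From mathcomp Require Import all_classical all_reals all_analysis.
Import Order.TTheory GRing.Theory Num.Theory.
Import numFieldNormedType.Exports.

(* A representation close to [rho t] sends every generator to a reflection,
   so it amounts to 22 vectors of norm 1 or -1, orthogonal for commuting
   generators. For sign vectors e, e' differing in the k-th sign only, the
   planes spanned by p_e, p_e' and by m_e, m_e' are orthogonal and both lie in
   the orthogonal of l_(i,e_i), l_(j,e_j), where {i, j, k} = {1, 2, 3}; this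
   3-space must then be degenerate, which forces b(l_(i,e_i), l_(j,e_j)) = -1
   and makes p_e + p_e' and m_e + m_e' multiples of l_(i,e_i) + l_(j,e_j).
   Here t <> 0 enters: at t = 0 the vectors p_e and p_e' are opposite.
   Comparing the multiples along the edges of the cube shows that they do not
   depend on the edge, and then the Gram matrix of the 22 vectors depends on a
   single real parameter y = t / sqrt (1 - t^2). Hence the representations near
   [rho t] are the conjugates of the [rho s], and the entries of the Cayley
   transform of the conjugating isometry, together with y, form a chart with
   values in an open subset of R^10 x R. *)

Set Implicit Arguments.
Unset Strict Implicit.
Unset Printing Implicit Defensive.
Local Open Scope classical_set_scope.
Local Open Scope ring_scope.

(** * Smooth functions *)

(** No tangent space is computed: both directions of the chart are explicit formulas, smooth on open
    sets of the ambient spaces and inverse to each other. Two ambiguities stand in the way. A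
    reflection determines its normal vector only up to sign; the sign is fixed by pairing with the
    corresponding vector at the base point. Moreover, commuting reflections have normals that are
    orthogonal or parallel; the parallel case is excluded by comparing norms and, where the norms
    agree, by open inequalities on coordinates. The conjugating isometry is unique because the
    vectors of the model span the whole space, and it is the identity at the base point, so its
    Cayley transform exists nearby. As this isometry is given by a formula in the 22 vectors,
    smoothness reduces to arithmetic, square roots of positive functions and inverses of invertible
    matrices. *)

Section near_eq_differentiable.
Context {R : numFieldType} {V W : normedModType R}.

(** The difference g - f vanishes near x, so the zero map is its differential with no remainder to
    estimate. *)
Lemma near_eq_differentiable (f g : V -> W) (x : V) :
  (\near x, f x = g x) -> differentiable f x -> differentiable g x.
Proof.
move=> fg df.
have -> : g = f + (g - f) by rewrite addrC subrK.
apply: differentiableD => //.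
set z := g - f.
have zx : \forall y \near x, z y = 0.
  by near=> y; rewrite /z !fctE (near fg y) ?subrr //; near: y.
have h : continuous (\0 : {linear V -> W}) /\
    z \o shift x = cst (z x) + (\0 : {linear V -> W}) +o_ 0 id.
  split; first exact: cst_continuous.
  apply/eqaddoP => _ /posnumP[e]; near=> y.
  rewrite /= !fctE /= (nbhs_singleton zx) addr0 subr0.
  have -> : z (y + x) = 0.
    by near: y; move: zx; rewrite (near_shift 0) /= subr0.
  by rewrite normr0 mulr_ge0.
apply/diff_locallyP.
have dz : 'd z x = (\0 : {linear V -> W}) :> (V -> W).
  by apply: diff_unique; have [] := h.
by rewrite dz.
Unshelve. all: by end_near. Qed.

End near_eq_differentiable.

Section smooth_scalar.
Context {R : realType} {n : nat}.
Implicit Types (U : set 'rV[R]_n) (f g : 'rV[R]_n -> R).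

(** Scalar counterpart of [Ck_on], to which [Ck_on_row] leads back: the calculus is done entry by
    entry. *)
Fixpoint Ck (k : nat) U f : Prop :=
  match k with
  | 0 => forall x, U x -> {for x, continuous f}
  | k'.+1 => (forall x, U x -> differentiable f x) /\
             (forall v, Ck k' U (fun x => 'D_v f x))
  end.

Definition smooth U f := forall k, Ck k U f.

Lemma open_near U x : open U -> U x -> \forall y \near x, U y.
Proof. by move=> oU Ux; exact: open_nbhs_nbhs. Qed.

(** The rules for derivatives need differentiability, hence hold on U only, whereas ['D_v f] is a
    function on the whole space. This lemma takes the place of functional extensionality. *)
Lemma eq_Ck k U f g : open U -> (forall x, U x -> f x = g x) ->
  Ck k U f -> Ck k U g.
Proof.
move=> oU; elim: k f g => [|k IH] f g fg /=.
  move=> cf x Ux; have := cf x Ux.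
  have nfg : \near x, f x = g x by near=> y; apply: fg; near: y; exact: open_near.
  rewrite /prop_for /continuous_at (nbhs_singleton nfg) => cfx.
  apply: cvg_trans cfx; exact: (near_eq_cvg nfg).
have nfg x : U x -> \near x, f x = g x.
  by move=> Ux; near=> y; apply: fg; near: y; exact: open_near.
move=> [df Df]; split=> [x Ux|v].
  by apply: near_eq_differentiable (df x Ux); exact: nfg.
by apply: IH (Df v) => x Ux; apply: near_eq_derive; exact: nfg.
Unshelve. all: by end_near. Qed.

Lemma CkW k U f : Ck k.+1 U f -> Ck k U f.
Proof.
elim: k f => [|k IH] f [df Df].
  by move=> x Ux; apply: differentiable_continuous; exact: df.
by split=> // v; exact: IH.
Qed.

Lemma Ck_cst k U (a : R) : Ck k U (fun=> a).
Proof.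
elim: k a => [|k IH] a /=; first by move=> x _; exact: cst_continuous.
split=> [x _|v]; first exact: differentiable_cst.
have -> : (fun x => 'D_v (fun=> a) x) = (fun=> 0) by apply/funext => x; exact: derive_cst.
exact: IH.
Qed.

Lemma CkD k U f g : open U -> Ck k U f -> Ck k U g -> Ck k U (fun x => f x + g x).
Proof.
move=> oU; elim: k f g => [|k IH] f g /=.
  by move=> cf cg x Ux; apply: continuousD; [exact: cf|exact: cg].
move=> [df Df] [dg Dg]; split=> [x Ux|v].
  by apply: differentiableD; [exact: df|exact: dg].
apply: (@eq_Ck _ _ (fun x => 'D_v f x + 'D_v g x)) => // [x Ux|]; last exact: IH.
by rewrite -deriveD //; apply: diff_derivable; [exact: df|exact: dg].
Qed.

Lemma CkM k U f g : open U -> Ck k U f -> Ck k U g -> Ck k U (fun x => f x * g x).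
Proof.
move=> oU; elim: k f g => [|k IH] f g.
  by move=> cf cg x Ux; apply: continuousM; [exact: cf|exact: cg].
(* The Leibniz rule keeps one factor underived, so both factors are also needed at one order
   less. *)
move=> cf cg; have [cf' cg'] := (CkW cf, CkW cg).
case: cf cg => [df Df] [dg Dg]; split=> [x Ux|v].
  by apply: differentiableM; [exact: df|exact: dg].
apply: (@eq_Ck _ _ (fun x => f x * 'D_v g x + g x * 'D_v f x)) => // [x Ux|].
  have dfx : derivable f x v by apply: diff_derivable; exact: df.
  have dgx : derivable g x v by apply: diff_derivable; exact: dg.
  exact: esym (deriveM dfx dgx).
exact: (CkD oU (IH _ _ cf' (Dg v)) (IH _ _ cg' (Df v))).
Qed.

Lemma CkV k U f : open U -> (forall x, U x -> f x != 0) ->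
  Ck k U f -> Ck k U (fun x => (f x)^-1).
Proof.
move=> oU f0; elim: k => [|k IH].
  by move=> cf x Ux; apply: continuousV; [exact: f0|exact: cf].
move=> cf; have cf' := IH (CkW cf).
case: cf => [df Df]; split=> [x Ux|v].
  by apply: differentiableV; [exact: df|exact: f0].
(* The derivative is expressed through [(f x)^-1] itself, which the induction hypothesis covers. *)
apply: (@eq_Ck _ _ (fun x => (-1) * ((f x)^-1 * (f x)^-1) * 'D_v f x)) => // [x Ux|].
  rewrite deriveV; [|exact: f0|by apply: diff_derivable; exact: df].
  by rewrite -exprVn expr2 mulN1r.
apply: (CkM oU _ (Df v)); apply: (CkM oU (Ck_cst _ _ _)).
exact: (CkM oU cf' cf').
Qed.

Lemma differentiable_sqrt (x : R) : 0 < x -> differentiable (Num.sqrt : R -> R) x.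
Proof. by move=> x0; apply/derivable1_diffP; case: (is_derive1_sqrt x0). Qed.

Lemma derive_sqrt f x v : 0 < f x -> differentiable f x ->
  'D_v (fun y => Num.sqrt (f y)) x = (2 * Num.sqrt (f x))^-1 * 'D_v f x.
Proof.
move=> f0 df.
have ds := differentiable_sqrt f0.
have dsf := differentiable_comp df ds.
rewrite [RHS]mulrC -[LHS]/('D_v ((Num.sqrt : R -> R) \o f) x).
rewrite (deriveE v dsf) (diff_comp df ds) /= -(deriveE v df).
rewrite -[X in 'd _ _ X]mulr1 [LHS]linearZ /=; congr (_ * _).
by rewrite -(deriveE (1 : R^o) ds); case: (is_derive1_sqrt f0) => _ <-.
Qed.

Lemma Ck_sqrt k U f : open U -> (forall x, U x -> 0 < f x) ->
  Ck k U f -> Ck k U (fun x => Num.sqrt (f x)).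
Proof.
move=> oU f0; elim: k => [|k IH].
  move=> cf x Ux; apply: (@continuous_comp _ _ _ f (Num.sqrt : R -> R)).
    exact: cf.
  exact: sqrt_continuous.
move=> cf; have cf' := IH (CkW cf).
case: cf => [df Df]; split=> [x Ux|v].
  apply: (@differentiable_comp _ _ _ _ f (Num.sqrt : R -> R)); first exact: df.
  exact: differentiable_sqrt (f0 x Ux).
apply: (@eq_Ck _ _ (fun x => (2 * Num.sqrt (f x))^-1 * 'D_v f x)) => // [x Ux|].
  by rewrite derive_sqrt //; [exact: f0|exact: df].
apply: (CkM oU _ (Df v)); apply: (CkV oU) => [x Ux|].
  by rewrite mulf_neq0 // ?pnatr_eq0 // gt_eqF // sqrtr_gt0 f0.
exact: (CkM oU (Ck_cst _ _ _) cf').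
Qed.

Lemma Ck_coord k U j : Ck k U (fun x => x 0 j).
Proof.
case: k => [|k] /=; first by move=> x _; exact: coord_continuous.
split=> [x _|v]; first exact: differentiable_coord.
have -> : (fun x => 'D_v (fun y : 'rV_n => y 0 j) x) = (fun=> v 0 j).
  apply/funext => x.
  have /matrixP/(_ 0 j) := derive_mx (@derivable_id _ 'rV[R]_n x v).
  by rewrite derive_id mxE => <-.
exact: Ck_cst.
Qed.

End smooth_scalar.

Section smooth_row.
Context {R : realType} {n m : nat}.

Lemma Ck_on_row k (U : set 'rV[R]_n) (f : 'rV[R]_n -> 'rV[R]_m) :
  open U -> (forall j, Ck k U (fun x => f x 0 j)) -> Ck_on k U f.
Proof.
move=> oU.
have fE (h : 'rV[R]_n -> 'rV[R]_m) :
    h = \sum_(j < m) (fun x => h x 0 j *: (delta_mx 0 j : 'rV[R]_m)).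
  apply/funext => x; rewrite {1}(row_sum_delta (h x)) fct_sumE.
  by apply: eq_bigr => j _.
have dfE (h : 'rV[R]_n -> 'rV[R]_m) x :
    (forall j, differentiable (fun y => h y 0 j) x) -> differentiable h x.
  move=> dh; rewrite (fE h).
  by apply: differentiable_sum => j; apply: differentiableZl.
elim: k f => [|k IH] f cf /=.
  move=> x Ux; rewrite (fE f) /prop_for.
  have -> : \sum_(j < m) (fun y : 'rV[R]_n => f y 0 j *: (delta_mx 0 j : 'rV[R]_m))
    = (fun y => \sum_(j < m) f y 0 j *: (delta_mx 0 j : 'rV[R]_m)).
    by apply/funext => y; rewrite fct_sumE.
  apply: (cvg_big _ (nbhs_filter x)) => [|j _]; first exact: add_continuous.
  apply: cvgZr_tmp; exact: cf.
split=> [x Ux|v]; first by apply: dfE => j; exact: (cf j).1.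
have DE x j : U x -> ('D_v f x) 0 j = 'D_v (fun y => f y 0 j) x.
  move=> Ux; rewrite derive_mx ?mxE //; apply: diff_derivable.
  by apply: dfE => i; exact: (cf i).1.
apply: IH => j; apply: (@eq_Ck _ _ _ _ (fun x => 'D_v (fun y => f y 0 j) x)) => //.
  by move=> x Ux; rewrite DE.
exact: (cf j).2.
Qed.

End smooth_row.

(** * The quadratic form *)

Section AdS_form.
Context {R : realType}.
Implicit Types (x y z : 'cV[R]_5) (a : R).

Lemma ord5E (i : 'I_5) : i = 0 \/ i = 1 \/ i = 2 \/ i = 3 \/ i = 4.
Proof.
case: i => [[|[|[|[|[|i]]]]] Hi] //; [|right|do 2 right|do 3 right|do 4 right];
  try left; exact: val_inj.
Qed.

Lemma ord3E (i : 'I_3) : i = 0 \/ i = 1 \/ i = 2.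
Proof.
case: i => [[|[|[|i]]] Hi] //; [left|right; left|right; right];
  exact: val_inj.
Qed.

Lemma sum5E (V : nmodType) (F : 'I_5 -> V) : \sum_i F i = F 0 + F 1 + F 2 + F 3 + F 4.
Proof.
rewrite !big_ord_recr big_ord0 /= add0r.
by do !congr (_ + _); congr F; exact: val_inj.
Qed.

Lemma b_AdSC x y : b_AdS x y = b_AdS y x.
Proof. by rewrite /b_AdS; ring. Qed.

Lemma b_AdSDr x y z : b_AdS x (y + z) = b_AdS x y + b_AdS x z.
Proof. by rewrite /b_AdS !mxE; ring. Qed.

Lemma b_AdSZr x a y : b_AdS x (a *: y) = a * b_AdS x y.
Proof. by rewrite /b_AdS !mxE; ring. Qed.

Lemma b_AdSNr x y : b_AdS x (- y) = - b_AdS x y.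
Proof. by rewrite -scaleN1r b_AdSZr mulN1r. Qed.

Lemma b_AdS0r x : b_AdS x 0 = 0.
Proof. by rewrite -(scale0r 0) b_AdSZr mul0r. Qed.

Lemma b_AdSDl x y z : b_AdS (y + z) x = b_AdS y x + b_AdS z x.
Proof. by rewrite !(b_AdSC _ x) b_AdSDr. Qed.

Lemma b_AdSZl x a y : b_AdS (a *: y) x = a * b_AdS y x.
Proof. by rewrite !(b_AdSC _ x) b_AdSZr. Qed.

Lemma b_AdSNl x y : b_AdS (- y) x = - b_AdS y x.
Proof. by rewrite !(b_AdSC _ x) b_AdSNr. Qed.

Lemma b_AdS0l x : b_AdS 0 x = 0.
Proof. by rewrite b_AdSC b_AdS0r. Qed.

Definition b_AdSE := (b_AdSDr, b_AdSNr, b_AdSZr, b_AdS0r,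
  b_AdSDl, b_AdSNl, b_AdSZl, b_AdS0l).

Lemma q_AdSZ a x : q_AdS (a *: x) = a ^+ 2 * q_AdS x.
Proof. by rewrite -!b_AdSxx !b_AdSE; ring. Qed.

Definition J_AdS : 'M[R]_5 := diag_mx (vec5 (-1) 1 1 1 (-1))^T.

Lemma J_AdSK : J_AdS *m J_AdS = 1%:M.
Proof.
apply/matrixP => i j; rewrite mul_diag_mx !mxE.
by case: (ord5E i) => [->|[->|[->|[->|->]]]]; case: (ord5E j) => [->|[->|[->|[->|->]]]] /=; ring.
Qed.

Lemma tr_J_AdS : J_AdS^T = J_AdS.
Proof. exact: tr_diag_mx. Qed.

Lemma mulJ_AdS x : J_AdS *m x = vec5 (- x 0 0) (x 1 0) (x 2 0) (x 3 0) (- x 4 0).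
Proof.
apply/colP => i; rewrite mul_diag_mx !mxE.
by case: (ord5E i) => [->|[->|[->|[->|->]]]] /=; ring.
Qed.

Lemma b_AdS_mx x y : b_AdS x y = (x^T *m J_AdS *m y) 0 0.
Proof.
by rewrite -mulmxA mulJ_AdS mxE sum5E /b_AdS !mxE /=; ring.
Qed.

Lemma b_AdS_gram (A : 'M[R]_5) x y :
  b_AdS (A *m x) (A *m y) = (x^T *m (A^T *m J_AdS *m A) *m y) 0 0.
Proof. by rewrite b_AdS_mx trmx_mul !mulmxA. Qed.

(** The s i are the rows of a square matrix A. Either A has a left kernel vector, or
    [A *m (J_AdS *m x) = 0] forces x = 0. This replaces a discussion of degenerate subspaces. *)
Lemma det_or_dependent (s : 'I_5 -> 'cV[R]_5) :
  (forall x, (forall i, b_AdS (s i) x = 0) -> x = 0) \/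
  exists2 v : 'rV[R]_5, v != 0 & \sum_i v 0 i *: s i = 0.
Proof.
pose A : 'M[R]_5 := \matrix_(i, j) s i j 0.
have [/det0P[v v0 vA]|detA] := boolP (\det A == 0); [right|left]; last first.
  move=> x sx.
  have uA : A \in unitmx by rewrite unitmxE unitfE.
  have Ax : A *m (J_AdS *m x) = 0.
    apply/colP => i; rewrite [RHS]mxE -(sx i) b_AdS_mx -mulmxA [LHS]mxE [RHS]mxE.
    by apply: eq_bigr => j _; rewrite !mxE.
  rewrite -[x]mul1mx -J_AdSK -mulmxA.
  by rewrite -(mulKmx uA (J_AdS *m x)) Ax mulmx0 mulmx0.
exists v => //; apply/colP => j; rewrite summxE mxE.
transitivity ((v *m A) 0 j); last by rewrite vA mxE.
by rewrite mxE; apply: eq_bigr => i _; rewrite !mxE.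
Qed.

End AdS_form.

(* Otherwise a, b span a nondegenerate plane, so that the planes spanned by
   p, p' and by m, m' are orthogonal in a nondegenerate 3-space. *)
Lemma edge_degenerate (R : realType) (a b p p' m m' : 'cV[R]_5) (e : R) :
  e ^+ 2 = 1 -> q_AdS a = 1 -> q_AdS b = 1 ->
  q_AdS p = e -> q_AdS p' = e -> q_AdS m = - e -> q_AdS m' = - e ->
  b_AdS a p = 0 -> b_AdS a p' = 0 -> b_AdS a m = 0 -> b_AdS a m' = 0 ->
  b_AdS b p = 0 -> b_AdS b p' = 0 -> b_AdS b m = 0 -> b_AdS b m' = 0 ->
  b_AdS p m = 0 -> b_AdS p m' = 0 -> b_AdS p' m = 0 -> b_AdS p' m' = 0 ->
  b_AdS a b < 0 -> e * b_AdS p p' < 0 -> (- e) * b_AdS m m' < 0 ->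
  a + b != 0 -> p + p' != 0 -> m + m' != 0 ->
  b_AdS a b = -1 /\ exists c, p + p' = c *: (a + b).
Proof.
move=> e2 qa qb qp qp' qm qm' ap ap' am am' bp bp' bm bm' pm pm' p'm p'm'.
move=> ab_lt0 pp' mm' ab0 pp0 mm0.
pose s (i : 'I_5) := [:: a; b; p; p'; m]`_i.
have [ort|[v v0]] := det_or_dependent s.
  (* The component of m' orthogonal to m is orthogonal to all five vectors, hence zero. So m' is m
     or - m: the sign of b(m, m') excludes the first and [mm0] the second. *)
  exfalso; have m'E : m' + (e * b_AdS m m') *: m = 0.
    apply: ort => i; rewrite /s b_AdSDr b_AdSZr; case: (ord5E i) => [->|[->|[->|[->|->]]]] /=.
    - by rewrite am am'; ring.
    - by rewrite bm bm'; ring.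
    - by rewrite pm pm'; ring.
    - by rewrite p'm p'm'; ring.
    - by rewrite b_AdSxx qm; transitivity ((1 - e ^+ 2) * b_AdS m m'); [ring|rewrite e2; ring].
  have h2 : (e * b_AdS m m') ^+ 2 = 1.
    have : q_AdS m' = q_AdS ((e * b_AdS m m') *: m).
      by move: m'E => /addr0_eq <-; rewrite -!b_AdSxx !b_AdSE; ring.
    rewrite q_AdSZ qm qm' => h.
    have hX : (e * b_AdS m m') ^+ 2 * e = e by move: h; rewrite mulrN => /oppr_inj.
    by rewrite -[LHS]mulr1 -e2 [e ^+ 2]expr2 mulrA hX -expr2.
  have h1 : e * b_AdS m m' = 1.
    have /eqP := h2; rewrite sqrf_eq1 => /orP[/eqP//|/eqP h].
    by move: mm'; rewrite mulNr h; lra.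
  by move/eqP: mm0; apply; rewrite addrC -m'E h1 scale1r.
rewrite sum5E /s /=.
have coef i : exists c : R, v 0 i = c by exists (v 0 i).
have [x Ex] := coef 0; have [y Ey] := coef 1; have [z Ez] := coef 2.
have [w Ew] := coef 3; have [u Eu] := coef 4; rewrite Ex Ey Ez Ew Eu => rel.
have u0 : u = 0.
  have := congr1 (b_AdS m) rel; rewrite !b_AdSE !(b_AdSC m) am bm pm p'm b_AdSxx qm => h.
  have h' : u * - e = 0 by rewrite -[RHS]h; ring.
  by rewrite -[u]mul1r -e2; transitivity (- e * (u * - e)); [ring|rewrite h' mulr0].
have rel0 : x *: a + y *: b + z *: p + w *: p' = 0 by rewrite -[RHS]rel u0 scale0r addr0.
have Ea := congr1 (b_AdS a) rel0; have Eb := congr1 (b_AdS b) rel0.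
have Ep := congr1 (b_AdS p) rel0; have Ep' := congr1 (b_AdS p') rel0.
move: Ea Eb Ep Ep'; rewrite !b_AdSE !b_AdSxx qa qb qp qp'.
rewrite (b_AdSC b a) (b_AdSC p' p) !(b_AdSC p a) !(b_AdSC p' a) !(b_AdSC p b) !(b_AdSC p' b).
rewrite ap ap' bp bp' => Ea Eb Ep Ep'.
(* The relation is symmetric within each pair: the sign hypotheses keep 1 - b(a, b) and 1 - e * b(p,
   p') positive. *)
have xy : x = y.
  have : (x - y) * (1 - b_AdS a b) = 0.
    by rewrite -[RHS]subr0 -{1}Ea -[X in _ = _ - X]Eb; ring.
  by move/eqP; rewrite mulf_eq0 => /orP[/eqP|/eqP] ?; lra.
have zw : z = w.
  have : (z - w) * (1 - e * b_AdS p p') = 0.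
    transitivity (e * ((z - w) * (e - b_AdS p p'))); first by rewrite -e2; ring.
    have -> : (z - w) * (e - b_AdS p p') = 0.
      by rewrite -[RHS]subr0 -{1}Ep -[X in _ = _ - X]Ep'; ring.
    by rewrite mulr0.
  by move/eqP; rewrite mulf_eq0 => /orP[/eqP|/eqP] ?; lra.
have rel1 : x *: (a + b) + z *: (p + p') = 0.
  by rewrite -[RHS]rel0 -xy -zw !scalerDr !addrA.
have z0 : z != 0.
  apply/negP => /eqP z0; move: rel1; rewrite z0 scale0r addr0 => /eqP.
  rewrite scaler_eq0 (negPf ab0) orbF => /eqP x0; move/negP: v0; apply.
  apply/eqP/rowP => i; rewrite mxE; case: (ord5E i) => [->|[->|[->|[->|->]]]].
  - by rewrite Ex.
  - by rewrite Ey -xy.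
  - by rewrite Ez.
  - by rewrite Ew -zw.
  - by rewrite Eu.
have x0 : x != 0.
  apply/negP => /eqP x0; move: rel1; rewrite x0 scale0r add0r => /eqP.
  by rewrite scaler_eq0 (negPf pp0) (negPf z0).
split.
  have : x * (1 + b_AdS a b) = 0 by rewrite -[RHS]Ea -xy; ring.
  by move/eqP; rewrite mulf_eq0 (negPf x0) => /eqP ?; lra.
exists (- (x / z)); apply: (scalerI z0).
rewrite scalerA mulrN mulrCA mulfV // mulr1 scaleNr.
by apply/eqP; rewrite -addr_eq0 addrC rel1.
Qed.

(** * Edges of the cube *)

Definition flip (k : 'I_3) (e : signs) : signs := [ffun i => e i (+) (i == k)].

Lemma flipK k : involutive (flip k).
Proof. by move=> e; apply/ffunP => i; rewrite !ffunE -addbA addbb addbF. Qed.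

Lemma flip_same k e : flip k e k = ~~ e k.
Proof. by rewrite ffunE eqxx addbT. Qed.

Lemma flip_diff k i e : i != k -> flip k e i = e i.
Proof. by rewrite ffunE => /negPf ->; rewrite addbF. Qed.

(** Induction on the number of minus signs, encoded by [true]: the cube is connected through its
    edges. *)
Lemma flip_ind (P : signs -> Prop) :
  P [ffun=> false] -> (forall k e, P e -> P (flip k e)) -> forall e, P e.
Proof.
move=> P0 PS e; move En : #|[set k | e k]%SET| => n.
elim: n e En => [|n IH] e.
  move/eqP; rewrite cards_eq0 => /eqP e0.
  suff -> : e = [ffun=> false] by [].
  apply/ffunP => i; rewrite ffunE; apply/negbTE/negP => ei.
  have : i \in [set k | e k]%SET by rewrite inE.
  by rewrite e0 inE.
move=> En; have /card_gt0P[k] : (0 < #|[set k | e k]%SET|)%N by rewrite En.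
rewrite inE => ek; rewrite -(flipK k e); apply/PS/IH.
move: En; rewrite (cardsD1 k) inE ek add1n => -[<-].
apply: eq_card => i; rewrite !inE ffunE.
by case: eqVneq => [->|]; rewrite ?ek //= addbF.
Qed.

Lemma flip_invariant (T : Type) (F : signs -> T) :
  (forall k e, F (flip k e) = F e) -> forall e e', F e = F e'.
Proof.
move=> FS; suff F0 e : F e = F [ffun=> false] by move=> e e'; rewrite !F0.
by elim/flip_ind: e => // k e <-.
Qed.

Lemma ord3D (k : 'I_3) : [&& k + 1 != k, k + 2 != k & k + 1 != k + 2].
Proof. by case: (ord3E k) => [->|[->|->]]. Qed.

(** Two distinct indices modulo 3 are k + 1 and k + 2 in some order, k being the third one. This is
    the form in which they occur in [edge_sum]. *)
Lemma ord3D_ind (P : 'I_3 -> 'I_3 -> Prop) :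
  (forall i j, P i j -> P j i) -> (forall k, P (k + 1) (k + 2)) ->
  forall i j, i != j -> P i j.
Proof.
move=> Ps P12 i j.
have e1 : (2 + 1 : 'I_3) = 0 by apply/val_inj.
have e2 : (2 + 2 : 'I_3) = 1 by apply/val_inj.
have e3 : (1 + 1 : 'I_3) = 2 by apply/val_inj.
have e4 : (1 + 2 : 'I_3) = 0 by apply/val_inj.
have P01 := P12 2; have P20 := P12 1; have P12' := P12 0.
rewrite {}e1 {}e2 in P01; rewrite {}e3 {}e4 in P20; rewrite !add0r in P12'.
by case: (ord3E i) => [->|[->|->]]; case: (ord3E j) => [->|[->|->]] // _; auto.
Qed.

(** * Edge relations for one family of vectors indexed by the cube *)

Section families.
Context {R : realType}.
Variable l : 'I_3 -> bool -> 'cV[R]_5.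
Hypothesis ql : forall k s, q_AdS (l k s) = 1.
Hypothesis bl : forall i j s s', i != j -> b_AdS (l i s) (l j s') = -1.

(* Addition in 'I_3 is modulo 3: k + 1 and k + 2 are the two indices other
   than k. *)
Definition edge_sum (e : signs) k := l (k + 1) (e (k + 1)) + l (k + 2) (e (k + 2)).

Definition gapl i := 1 - b_AdS (l i true) (l i false).

Lemma b_l_edge_sum e k i : i != k ->
  b_AdS (edge_sum e k) (l i (~~ e i)) = - gapl i.
Proof.
have ll j s : b_AdS (l j s) (l j (~~ s)) = b_AdS (l j true) (l j false).
  by case: s => //=; rewrite b_AdSC.
have /and3P[k1 k2 k12] := ord3D k.
have : [|| i == k, i == k + 1 | i == k + 2].
  by case: (ord3E k) => [->|[->|->]]; case: (ord3E i) => [->|[->|->]].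
rewrite /edge_sum /gapl b_AdSDl => /or3P[->//| |] /eqP -> _; rewrite ll.
  by rewrite (bl _ _ (_ : k + 2 != k + 1)) 1?eq_sym //; lra.
by rewrite (bl _ _ k12); lra.
Qed.

Section family.
Variable u : signs -> 'cV[R]_5.
Hypothesis ul : forall e k, b_AdS (u e) (l k (e k)) = 0.
Hypothesis uedge : forall e k, exists c, u e + u (flip k e) = c *: edge_sum e k.

(* The coefficient in [uedge], read off by pairing with l k (~~ e k), which is
   orthogonal to u (flip k e). *)
Definition slope e k := - b_AdS (u e) (l k (~~ e k)) / 2.

Lemma slope_edge e k : u e + u (flip k e) = slope e k *: edge_sum e k.
Proof.
have [c uc] := uedge e k; rewrite uc; congr (_ *: _).
have := congr1 (b_AdS (l k (~~ e k))) uc.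
have h : b_AdS (u (flip k e)) (l k (~~ e k)) = 0 by rewrite -flip_same ul.
have /and3P[k1 k2 _] := ord3D k.
rewrite /slope !b_AdSE (b_AdSC _ (u _)) (b_AdSC _ (u (flip _ _))) h.
by rewrite !bl 1?eq_sym //; lra.
Qed.

Lemma slope_flip_same e k : slope (flip k e) k = slope e k.
Proof.
have := slope_edge (flip k e) k; rewrite flipK addrC slope_edge => h.
have /and3P[k1 k2 _] := ord3D k.
have := congr1 (b_AdS (l k true)) h; rewrite !b_AdSE.
by rewrite !bl 1?eq_sym //; lra.
Qed.

(** The edge relation in direction k is paired with [l i (~~ e i)]: one side reads off the slopes in
    direction i at both ends of the edge, the other side the gap. *)
Lemma slope_flip_diff e k i : i != k ->
  gapl i * slope e k = 2 * (slope e i + slope (flip k e) i).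
Proof.
move=> ik; have := congr1 (b_AdS (l i (~~ e i))) (slope_edge e k).
rewrite b_AdSDr b_AdSZr (b_AdSC _ (edge_sum _ _)) b_l_edge_sum //.
by rewrite /slope (flip_diff _ ik) !(b_AdSC (l _ _) (u _)); lra.
Qed.

Hypothesis gapl_neq0 : forall i, gapl i != 0.

(** By [slope_flip_same], the right-hand side of [slope_flip_diff] does not change when the i-th
    sign is flipped; dividing by the gap gives the same for the slope in direction k. *)
Lemma slope_const e e' k : slope e k = slope e' k.
Proof.
suff Sf i f : slope (flip i f) k = slope f k.
  exact: (flip_invariant (F := fun f => slope f k)).
have [->|ik] := eqVneq i k; first exact: slope_flip_same.
apply: (mulfI (gapl_neq0 i)); rewrite !slope_flip_diff //.
rewrite slope_flip_same; congr (2 * (_ + _)).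
suff -> : flip k (flip i f) = flip i (flip k f) by rewrite slope_flip_same.
by apply/ffunP => j; rewrite !ffunE -!addbA (addbC (j == i)).
Qed.

Lemma slope_gap e e' k i : i != k -> gapl i * slope e k = 4 * slope e' i.
Proof.
move=> ik; rewrite slope_flip_diff // (slope_const (flip k e) e').
by rewrite (slope_const e e'); ring.
Qed.

End family.
End families.

(** * The one-parameter model *)

Section normals.
Context {R : realType}.
Implicit Types (v : gen22 -> 'cV[R]_5) (y : R).

(** With y = t / sqrt (1 - t^2), the normalising factor of [f_AdS] becomes c. The pair (y, c) runs
    over a branch of the hyperbola c^2 - y^2 = 1, and y ranges over all reals. *)
Definition model y (g : gen22) : 'cV[R]_5 :=
  let c := Num.sqrt (1 + y ^+ 2) in
  match g with
  | gen_p e => vec5 (Num.sqrt 2 * y) (y * sgn R (e 0)) (y * sgn R (e 1))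
      (y * sgn R (e 2)) (c * sigma R e)
  | gen_m e => vec5 (Num.sqrt 2 * c) (c * sgn R (e 0)) (c * sgn R (e 1))
      (c * sgn R (e 2)) (y * sigma R e)
  | gen_l k s => delta_mx 0 0 + (sgn R s * Num.sqrt 2) *: delta_mx (inord k.+1) 0
  end.

Definition qsign (g : gen22) : R := if g is gen_p _ then -1 else 1.

(* Open conditions satisfied by [model y] when y is not 0; the last two keep
   m_e and l_(k,e_k), which have the same norm, from being parallel. *)
Record in_position v : Prop := InPosition {
  sep_ll : forall i j s s', i != j ->
    b_AdS (v (gen_l i s)) (v (gen_l j s')) < 0;
  sep_pp : forall e k, 0 < b_AdS (v (gen_p e)) (v (gen_p (flip k e)));
  sep_mm : forall e k, b_AdS (v (gen_m e)) (v (gen_m (flip k e))) < 0;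
  sep_p0 : forall e k, v (gen_p e) 0 0 + v (gen_p (flip k e)) 0 0 != 0;
  sep_m0 : forall e, 0 < v (gen_m e) 0 0;
  sep_l0 : forall k s, 0 < v (gen_l k s) 0 0;
  sep_mk : forall (e : signs) k,
    sgn R (e k) * v (gen_m e) (inord k.+1) 0 < v (gen_m e) 0 0;
  sep_lk : forall k s,
    v (gen_l k s) 0 0 < sgn R s * v (gen_l k s) (inord k.+1) 0 }.

Record admissible v : Prop := Admissible {
  adm_q : forall g, q_AdS (v g) = qsign g;
  adm_comm : forall g h, commuting22 g h -> b_AdS (v g) (v h) = 0;
  adm_sep : in_position v }.

Definition all_plus : signs := [ffun=> false].

(* The axes express the standard basis through the vectors of the model, so
   that [frame v] is the only candidate for an isometry mapping it to v. *)
Definition axis0 v := 2^-1 *: (v (gen_l 0 false) + v (gen_l 0 true)).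
Definition axis v k :=
  (2 * Num.sqrt 2)^-1 *: (v (gen_l k false) - v (gen_l k true)).
(** In the model, b(p_e, e_0) = - sqrt 2 * y. The next definition solves p = y * w + sqrt (1 + y^2)
    * e_4 for e_4, with w = sqrt 2 * e_0 + e_1 + e_2 + e_3 and p taken at [all_plus], where sigma is
    1. *)
Definition param v := - b_AdS (v (gen_p all_plus)) (axis0 v) / Num.sqrt 2.
Definition axis4 v := (Num.sqrt (1 + param v ^+ 2))^-1 *:
  (v (gen_p all_plus) - param v *: (Num.sqrt 2 *: axis0 v + axis v 0 + axis v 1 + axis v 2)).

Definition frame v : 'M[R]_5 := \matrix_(i, j)
  [:: axis0 v; axis v 0; axis v 1; axis v 2; axis4 v]`_j i 0.

Lemma frame_mul v (x : 'cV[R]_5) : frame v *m x =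
  x 0 0 *: axis0 v + x 1 0 *: axis v 0 + x 2 0 *: axis v 1 + x 3 0 *: axis v 2
  + x 4 0 *: axis4 v.
Proof.
by apply/colP => i; rewrite !mxE sum5E !mxE /=; ring.
Qed.

Lemma sqrt2_gt0 : 0 < Num.sqrt 2 :> R. Proof. by rewrite sqrtr_gt0. Qed.
Lemma sqrt2_neq0 : Num.sqrt 2 != 0 :> R. Proof. by rewrite gt_eqF // sqrt2_gt0. Qed.
Lemma sqr_sqrt2 : Num.sqrt 2 ^+ 2 = 2 :> R. Proof. by rewrite sqr_sqrtr. Qed.
Lemma sqrt1D_gt0 y : 0 < Num.sqrt (1 + y ^+ 2).
Proof. by rewrite sqrtr_gt0 ltr_pwDl // sqr_ge0. Qed.
Lemma sqr_sqrt1D y : Num.sqrt (1 + y ^+ 2) ^+ 2 = 1 + y ^+ 2.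
Proof. by rewrite sqr_sqrtr // addr_ge0 // sqr_ge0. Qed.

Lemma sgn2 b : sgn R b * sgn R b = 1.
Proof. by case: b; rewrite /sgn /=; ring. Qed.

Lemma sigma3 e : sigma R e = sgn R (e 0) * sgn R (e 1) * sgn R (e 2).
Proof.
rewrite /sigma !big_ord_recr big_ord0 /= mul1r.
by do !congr (_ * _); congr (sgn R (e _)); exact: val_inj.
Qed.

Lemma sigma_flip k e : sigma R (flip k e) = - sigma R e.
Proof.
rewrite !sigma3 !ffunE.
by case: (ord3E k) => [->|[->|->]] /=; case: (e 0); case: (e 1); case: (e 2);
  rewrite /sgn /=; ring.
Qed.

Lemma gen_l_model y k s : model y (gen_l k s) =
  vec5 1 (if k == 0 then sgn R s * Num.sqrt 2 else 0)
    (if k == 1 then sgn R s * Num.sqrt 2 else 0)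
    (if k == 2 then sgn R s * Num.sqrt 2 else 0) 0.
Proof.
apply/colP => i; rewrite !mxE.
have inordE (j : 'I_5) m : (m < 5)%N -> (j == inord m) = (val j == m).
  by move=> m5; rewrite -val_eqE /= inordK.
by case: (ord3E k) => [->|[->|->]]; case: (ord5E i) => [->|[->|[->|[->|->]]]];
  rewrite inordE //= ?mulr1 ?mulr0 ?addr0 ?add0r.
Qed.

Definition model_edge y e k :=
  model y (gen_l (k + 1) (e (k + 1))) + model y (gen_l (k + 2) (e (k + 2))).

Lemma I3_add : (((1 + 1)%R = 2%R :> 'I_3) * ((1 + 2)%R = 0%R :> 'I_3) *
  ((2 + 1)%R = 0%R :> 'I_3) * ((2 + 2)%R = 1%R :> 'I_3))%type.
Proof. by do !split; apply: val_inj. Qed.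

Lemma sgnN b : sgn R (~~ b) = - sgn R b.
Proof. by case: b; rewrite /sgn /=; ring. Qed.

(** Flipping one sign cancels that coordinate and the sigma term, and what remains is a multiple of
    the two vectors l that keep their signs. *)
Lemma model_p_flip y e k : model y (gen_p e) + model y (gen_p (flip k e)) =
  (Num.sqrt 2 * y) *: model_edge y e k.
Proof.
rewrite /model_edge !gen_l_model /= sigma_flip; apply/colP => i; rewrite !mxE !ffunE.
have s2 := sqr_sqrt2.
by case: (ord3E k) => [->|[->|->]]; case: (ord5E i) => [->|[->|[->|[->|->]]]];
  rewrite ?I3_add ?add0r /= ?addbF ?addbT ?sgnN; ring: s2.
Qed.

Lemma model_m_flip y e k : model y (gen_m e) + model y (gen_m (flip k e)) =
  (Num.sqrt 2 * Num.sqrt (1 + y ^+ 2)) *: model_edge y e k.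
Proof.
rewrite /model_edge !gen_l_model /= sigma_flip; apply/colP => i; rewrite !mxE !ffunE.
have s2 := sqr_sqrt2.
by case: (ord3E k) => [->|[->|->]]; case: (ord5E i) => [->|[->|[->|[->|->]]]];
  rewrite ?I3_add ?add0r /= ?addbF ?addbT ?sgnN; ring: s2.
Qed.

End normals.

(** * Rigidity *)

Lemma card_diff_flip k (e : signs) : (#|[set i | e i != flip k e i]%SET| <= 1)%N.
Proof.
rewrite (_ : [set i | _]%SET = [set k]%SET) ?cards1 //.
apply/setP => i; rewrite !inE ffunE.
by case: (eqVneq i k) => [->|_]; rewrite ?addbT ?addbF ?eqxx //; case: (e k).
Qed.

Lemma card_diff_same (e : signs) : (#|[set i | e i != e i]%SET| <= 1)%N.
Proof.
rewrite (_ : [set i | _]%SET = finset.set0) ?cards0 //.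
by apply/setP => i; rewrite !inE eqxx.
Qed.

(** * Coordinates with respect to an isometric frame *)

Section gram.
Context {R : realType}.

Lemma gramE (A : 'M[R]_5) i j :
  (A^T *m J_AdS *m A) i j = b_AdS (col i A) (col j A).
Proof.
rewrite b_AdS_mx tr_col -row_mul [LHS]mxE [RHS]mxE.
by apply: eq_bigr => k _; congr (_ * _); rewrite [RHS]mxE.
Qed.

(** The inverse of A is [J_AdS *m A^T *m J_AdS]; the minus signs come from the negative directions 0
    and 4. *)
Lemma gram_expand (A : 'M[R]_5) x : A^T *m J_AdS *m A = J_AdS ->
  x = A *m vec5 (- b_AdS (col 0 A) x) (b_AdS (col 1 A) x) (b_AdS (col 2 A) x)
    (b_AdS (col 3 A) x) (- b_AdS (col 4 A) x).
Proof.
move=> AJA; have AJ : A *m (J_AdS *m A^T *m J_AdS) = 1%:M.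
  by apply: mulmx1C; rewrite -!mulmxA (mulmxA A^T) AJA J_AdSK.
rewrite -[LHS]mul1mx -AJ -!mulmxA; congr (A *m _); rewrite mulJ_AdS.
have E i : (A^T *m (J_AdS *m x)) i 0 = b_AdS (col i A) x.
  by rewrite b_AdS_mx tr_col -!mulmxA -row_mul [RHS]mxE.
by rewrite !E.
Qed.

End gram.

Section rigidity.
Context {R : realType}.
Variable v : gen22 -> 'cV[R]_5.
Hypothesis hv : admissible v.

Let l k s := v (gen_l k s).
Let p e := v (gen_p e).
Let m e := v (gen_m e).

Lemma edge_both (e : signs) k :
  [/\ b_AdS (l (k + 1) (e (k + 1))) (l (k + 2) (e (k + 2))) = -1,
      exists c, p e + p (flip k e) = c *: edge_sum l e k
    & exists c, m e + m (flip k e) = c *: edge_sum l e k].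
Proof.
have /and3P[k1 k2 k12] := ord3D k.
have pl (f : signs) i : b_AdS (l i (f i)) (p f) = 0.
  by rewrite b_AdSC; apply: (adm_comm hv) => /=.
have ml (f : signs) i : b_AdS (l i (f i)) (m f) = 0.
  by rewrite b_AdSC; apply: (adm_comm hv) => /=.
have pl' i : i != k -> b_AdS (l i (e i)) (p (flip k e)) = 0.
  by move=> ik; rewrite -(flip_diff e ik) pl.
have ml' i : i != k -> b_AdS (l i (e i)) (m (flip k e)) = 0.
  by move=> ik; rewrite -(flip_diff e ik) ml.
have pm f : b_AdS (p f) (m f) = 0.
  by apply: (adm_comm hv) => /=; exact: card_diff_same.
have pm' f : b_AdS (p f) (m (flip k f)) = 0.
  by apply: (adm_comm hv) => /=; exact: card_diff_flip.
have pm'' f : b_AdS (p (flip k f)) (m f) = 0.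
  by rewrite -[X in m X](flipK k) pm'.
have ne0 (x y : 'cV[R]_5) : 0 < x 0 0 -> 0 < y 0 0 -> x + y != 0.
  move=> x0 y0; apply/eqP => /colP/(_ 0); rewrite !mxE => xy.
  by have := addr_gt0 x0 y0; rewrite xy ltxx.
have l0 : edge_sum l e k != 0 by apply: ne0; apply: (sep_l0 (adm_sep hv)).
have m0 : m e + m (flip k e) != 0 by apply: ne0; apply: (sep_m0 (adm_sep hv)).
have p0 : p e + p (flip k e) != 0.
  apply/eqP => /colP/(_ 0); rewrite !mxE => h.
  by have := sep_p0 (adm_sep hv) e k; rewrite h eqxx.
have pp : -1 * b_AdS (p e) (p (flip k e)) < 0.
  by rewrite mulN1r oppr_lt0; apply: (sep_pp (adm_sep hv)).
have mm : 1 * b_AdS (m e) (m (flip k e)) < 0.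
  by rewrite mul1r; apply: (sep_mm (adm_sep hv)).
have ll := sep_ll (adm_sep hv) (e (k + 1)) (e (k + 2)) k12.
have [lq [pq mq]] : (forall i s, q_AdS (l i s) = 1) /\
    (forall f, q_AdS (p f) = -1) /\ (forall f, q_AdS (m f) = 1).
  by split; [|split] => *; rewrite (adm_q hv).
have e1 : (-1) ^+ 2 = 1 :> R by rewrite sqrrN expr1n.
(* Here e = -1 is the norm of the vectors p. Below, the roles of p and m are exchanged and e = 1. *)
have [ab pc] := @edge_degenerate _ (l (k + 1) (e (k + 1))) (l (k + 2) (e (k + 2)))
  (p e) (p (flip k e)) (m e) (m (flip k e)) (-1) e1 (lq _ _) (lq _ _)
  (pq _) (pq _) (etrans (mq _) (esym (opprK 1))) (etrans (mq _) (esym (opprK 1)))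
  (pl _ _) (pl' _ k1) (ml _ _) (ml' _ k1) (pl _ _) (pl' _ k2) (ml _ _) (ml' _ k2)
  (pm _) (pm' _) (pm'' _) (pm _) ll pp
  (eq_ind_r (fun x => x * _ < 0) mm (opprK 1)) l0 p0 m0.
split => //.
have C := b_AdSC.
have [_ mc] := @edge_degenerate _ (l (k + 1) (e (k + 1))) (l (k + 2) (e (k + 2)))
  (m e) (m (flip k e)) (p e) (p (flip k e)) 1 (expr1n _ _) (lq _ _) (lq _ _)
  (mq _) (mq _) (pq _) (pq _)
  (ml _ _) (ml' _ k1) (pl _ _) (pl' _ k1) (ml _ _) (ml' _ k2) (pl _ _) (pl' _ k2)
  (etrans (C _ _ _) (pm _)) (etrans (C _ _ _) (pm'' _))
  (etrans (C _ _ _) (pm' _)) (etrans (C _ _ _) (pm _)) ll mm pp l0 m0 p0.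
exact: mc.
Qed.

Lemma bl i j s s' : i != j -> b_AdS (l i s) (l j s') = -1.
Proof.
move=> ij; move: i j ij s s'; apply: ord3D_ind => [i j h s s'|k s s'].
  by rewrite b_AdSC.
have /and3P[_ _ /negPf k12] := ord3D k.
(* Every pair of signs at k + 1 and k + 2 occurs in some sign vector. *)
have [] := edge_both [ffun i => if i == k + 1 then s else s'] k.
by rewrite !ffunE eqxx eq_sym k12.
Qed.

Lemma ql k s : q_AdS (l k s) = 1. Proof. exact: (adm_q hv). Qed.

Lemma pl (e : signs) k : b_AdS (p e) (l k (e k)) = 0.
Proof. by apply: (adm_comm hv) => /=. Qed.

Lemma ml (e : signs) k : b_AdS (m e) (l k (e k)) = 0.
Proof. by apply: (adm_comm hv) => /=. Qed.

Lemma pedge (e : signs) k : exists c, p e + p (flip k e) = c *: edge_sum l e k.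
Proof. by have [] := edge_both e k. Qed.

Lemma medge (e : signs) k : exists c, m e + m (flip k e) = c *: edge_sum l e k.
Proof. by have [] := edge_both e k. Qed.

(** The m family comes before the p family because positive coordinates at index 0 give its slopes a
    sign. This makes the gaps nonzero and later determines them. *)
Lemma slope_m_gt0 (e : signs) k : 0 < slope l m e k.
Proof.
have /(congr1 (fun x : 'cV_5 => x 0 0)) := slope_edge bl ml medge e k.
have s0 : 0 < (edge_sum l e k) 0 0 by rewrite mxE addr_gt0 //; apply: (sep_l0 (adm_sep hv)).
rewrite 2!mxE => h; rewrite -(pmulr_lgt0 _ s0) -h.
by rewrite addr_gt0 //; apply: (sep_m0 (adm_sep hv)).
Qed.

Lemma gapl_neq0 i : gapl l i != 0.
Proof.
have ik : i != i + 1 by rewrite eq_sym; have /and3P[] := ord3D i.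
have h := slope_flip_diff bl ml medge all_plus ik.
apply/eqP => g0; move: h; rewrite g0 mul0r => /esym /eqP.
by rewrite gt_eqF // mulr_gt0 // addr_gt0 // slope_m_gt0.
Qed.

(** By [slope_gap], [gapl i] times the slope in either of the two other directions is 4 times the
    slope in direction i. *)
Lemma slope_m_eq e e' k k' : slope l m e k = slope l m e' k'.
Proof.
rewrite (slope_const bl ml medge gapl_neq0 e e'); have [->//|kk] := eqVneq k k'.
pose P i j := slope l m e' i = slope l m e' j.
apply: (ord3D_ind (P := P)) kk => [i j //|i].
have /and3P[i1 i2 _] := ord3D i.
apply: (mulfI (gapl_neq0 i)).
rewrite eq_sym in i1; rewrite eq_sym in i2.
by rewrite !(slope_gap bl ml medge gapl_neq0 _ e').
Qed.

Lemma gapl4 i : gapl l i = 4.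
Proof.
have ik : i != i + 1 by rewrite eq_sym; have /and3P[] := ord3D i.
have := slope_gap bl ml medge gapl_neq0 all_plus all_plus ik.
rewrite (slope_m_eq _ all_plus _ i) => /mulIf; apply.
by rewrite gt_eqF // slope_m_gt0.
Qed.

(** The slopes of the p family have no prescribed sign and are not cancelled; the gap 4 obtained
    from the m family is cancelled instead. *)
Lemma slope_p_eq e e' k k' : slope l p e k = slope l p e' k'.
Proof.
have [<-|kk] := eqVneq k k'; first exact: (slope_const bl pl pedge gapl_neq0).
rewrite eq_sym in kk; have := slope_gap bl pl pedge gapl_neq0 e e' kk.
by rewrite gapl4 => /mulfI; apply; rewrite pnatr_eq0.
Qed.

Let alpha := slope l p all_plus 0.
Let beta := slope l m all_plus 0.

Lemma p_edge (e : signs) k : p e + p (flip k e) = alpha *: edge_sum l e k.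
Proof. by rewrite (slope_edge bl pl pedge) /alpha (slope_p_eq e all_plus k 0). Qed.

Lemma m_edge (e : signs) k : m e + m (flip k e) = beta *: edge_sum l e k.
Proof. by rewrite (slope_edge bl ml medge) /beta (slope_m_eq e all_plus k 0). Qed.

Lemma beta_gt0 : 0 < beta. Proof. exact: slope_m_gt0. Qed.

Lemma ll_opp k : b_AdS (l k true) (l k false) = -3.
Proof. by have := gapl4 k; rewrite /gapl; lra. Qed.

(** In the alternating sum of the edge relations around a square with directions i and j, all
    vectors m and those of index k cancel. What is left compares the two midpoints. *)
Lemma midpoint_eq i j : l i false + l i true = l j false + l j true.
Proof.
have [->//|ij] := eqVneq i j; move: i j ij.
apply: (ord3D_ind (P := fun i j => l i false + l i true = l j false + l j true)).
  by move=> i j.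
move=> k; set i := k + 1; set j := k + 2.
have /and3P[ik jk ij] := ord3D k; rewrite -/i -/j in ik jk ij.
have [ia ib ja jb] : [/\ i + 1 = j, i + 2 = k, j + 1 = k & j + 2 = i].
  rewrite /i /j; case: (ord3E k) => [->|[->|->]]; split; exact: val_inj.
have fij : flip j (flip i all_plus) = flip i (flip j all_plus).
  by apply/ffunP => x; rewrite !ffunE -!addbA (addbC (x == i)).
have e1 := m_edge all_plus i; have e2 := m_edge (flip i all_plus) j.
have e3 := m_edge (flip j all_plus) i; have e4 := m_edge all_plus j.
rewrite /edge_sum ia ib ja jb fij in e1 e2 e3 e4.
have all_plusE x : all_plus x = false by rewrite ffunE.
have ji : j != i by rewrite eq_sym.
have ki : k != i by rewrite eq_sym.
have kj : k != j by rewrite eq_sym.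
rewrite !(flip_same, flip_diff, all_plusE) //= in e1 e2 e3 e4.
apply: (scalerI (lt0r_neq0 beta_gt0)).
apply/colP => x.
move: (congr1 (fun y : 'cV_5 => y x 0) e1) (congr1 (fun y : 'cV_5 => y x 0) e2)
  (congr1 (fun y : 'cV_5 => y x 0) e3) (congr1 (fun y : 'cV_5 => y x 0) e4).
by rewrite !mxE; lra.
Qed.

Lemma axis0E k : axis0 v = 2^-1 *: (l k false + l k true).
Proof. by rewrite /axis0 (midpoint_eq 0 k). Qed.

Lemma b_axis0r x :
  b_AdS x (axis0 v) = 2^-1 * (b_AdS x (l 0 false) + b_AdS x (l 0 true)).
Proof. by rewrite b_AdSZr b_AdSDr. Qed.

Lemma b_axisr x i : b_AdS x (axis v i) =
  (2 * Num.sqrt 2)^-1 * (b_AdS x (l i false) - b_AdS x (l i true)).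
Proof. by rewrite b_AdSZr b_AdSDr b_AdSNr. Qed.

Lemma b_axis0_l k s : b_AdS (axis0 v) (l k s) = -1.
Proof.
by rewrite (axis0E k) !b_AdSE; case: s;
  rewrite b_AdSxx ql ?ll_opp ?(b_AdSC (l k false)) ?ll_opp; lra.
Qed.

Lemma sqrt2V : (2 * Num.sqrt 2)^-1 * 4 = Num.sqrt 2 :> R.
Proof.
apply: (mulfI (sqrt2_neq0 : Num.sqrt 2 != 0 :> R)).
rewrite -expr2 sqr_sqrt2; field; exact: sqrt2_neq0.
Qed.

Lemma b_axis_l i k s :
  b_AdS (axis v i) (l k s) = if i == k then sgn R s * Num.sqrt 2 else 0.
Proof.
rewrite /axis !b_AdSE -!/(l _ _); case: eqVneq => [->|ik].
  rewrite -[in RHS]sqrt2V; case: s; rewrite b_AdSxx ql ?ll_opp ?(b_AdSC (l k false)) ?ll_opp;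
    rewrite /sgn /=; ring.
by rewrite !bl //; ring.
Qed.

Lemma b_axis00 : b_AdS (axis0 v) (axis0 v) = -1.
Proof. by rewrite b_axis0r !b_axis0_l; lra. Qed.

Lemma b_axis0_axis i : b_AdS (axis0 v) (axis v i) = 0.
Proof. by rewrite b_axisr !b_axis0_l; ring. Qed.

Lemma b_axis_axis i j : b_AdS (axis v i) (axis v j) = (i == j)%:R.
Proof.
rewrite b_axisr !b_axis_l; case: eqP => _; last by rewrite subrr mulr0.
rewrite /sgn /=; field; exact: sqrt2_neq0.
Qed.

Lemma l_axisE k s : l k s = axis0 v + (sgn R s * Num.sqrt 2) *: axis v k.
Proof.
apply/colP => i; rewrite (axis0E k) !mxE -!/(l _ _).
by case: s; rewrite /sgn /=; field; exact: sqrt2_neq0.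
Qed.

Section family_coordinates.
Variables (u : signs -> 'cV[R]_5) (c : R).
Hypothesis ul : forall (e : signs) k, b_AdS (u e) (l k (e k)) = 0.
Hypothesis uc : forall (e : signs) k, slope l u e k = c.

Lemma family_l (e : signs) k s :
  b_AdS (u e) (l k s) = if s == e k then 0 else - 2 * c.
Proof.
case: eqVneq => [->|sk]; first exact: ul.
have -> : s = ~~ e k by move: sk; case: s; case: (e k).
by rewrite -(uc e k) /slope; lra.
Qed.

Lemma family_axis0 e : b_AdS (u e) (axis0 v) = - c.
Proof.
rewrite b_axis0r !family_l.
by case: (e 0) => /=; lra.
Qed.

Lemma family_axis (e : signs) k :
  b_AdS (u e) (axis v k) = c / Num.sqrt 2 * sgn R (e k).
Proof.
rewrite b_axisr !family_l.
by case: (e k); rewrite /sgn /=; field; exact: sqrt2_neq0.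
Qed.

End family_coordinates.

Let y := param v.
Let cy := Num.sqrt (1 + y ^+ 2).

Lemma param_slope (e : signs) k : slope l p e k = Num.sqrt 2 * y.
Proof.
have pa f i : slope l p f i = alpha by exact: slope_p_eq.
rewrite pa /y /param (family_axis0 pl pa) opprK; field; exact: sqrt2_neq0.
Qed.

Lemma p_axis0 e : b_AdS (p e) (axis0 v) = - (Num.sqrt 2 * y).
Proof. exact: (family_axis0 pl param_slope). Qed.

Lemma p_axis (e : signs) k : b_AdS (p e) (axis v k) = y * sgn R (e k).
Proof.
by rewrite (family_axis pl param_slope); field; exact: sqrt2_neq0.
Qed.

Let w := Num.sqrt 2 *: axis0 v + axis v 0 + axis v 1 + axis v 2.

Lemma cy_neq0 : cy != 0. Proof. by rewrite gt_eqF // sqrt1D_gt0. Qed.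

Lemma axis4E : axis4 v = cy^-1 *: (p all_plus - y *: w). Proof. by []. Qed.

Lemma sgn_all_plus k : sgn R (all_plus k) = 1.
Proof. by rewrite ffunE /sgn expr0. Qed.

Lemma b_wr x : b_AdS x w = Num.sqrt 2 * b_AdS x (axis0 v) + b_AdS x (axis v 0)
  + b_AdS x (axis v 1) + b_AdS x (axis v 2).
Proof. by rewrite /w b_AdSDr b_AdSDr b_AdSDr b_AdSZr. Qed.

Lemma b_axis4r x : b_AdS x (axis4 v) = cy^-1 * (b_AdS x (p all_plus) - y * b_AdS x w).
Proof. by rewrite axis4E b_AdSZr b_AdSDr b_AdSNr b_AdSZr. Qed.

Lemma axis0_w : b_AdS (axis0 v) w = - Num.sqrt 2.
Proof. by rewrite b_wr b_axis00 !b_axis0_axis; ring. Qed.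

Lemma axis_w k : b_AdS (axis v k) w = 1.
Proof.
rewrite b_wr (b_AdSC _ (axis0 v)) b_axis0_axis !b_axis_axis.
by case: (ord3E k) => [->|[->|->]] /=; ring.
Qed.

Lemma p_w : b_AdS (p all_plus) w = y.
Proof.
rewrite b_wr p_axis0 !p_axis !sgn_all_plus.
have s2 : Num.sqrt 2 ^+ 2 = 2 :> R := sqr_sqrt2.
by ring: s2.
Qed.

Lemma w_w : b_AdS w w = 1.
Proof.
rewrite b_wr !(b_AdSC w) axis0_w !axis_w.
have s2 : Num.sqrt 2 ^+ 2 = 2 :> R := sqr_sqrt2.
by ring: s2.
Qed.

Lemma axis0_axis4 : b_AdS (axis0 v) (axis4 v) = 0.
Proof. by rewrite b_axis4r (b_AdSC _ (p _)) p_axis0 axis0_w; ring. Qed.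

Lemma axis_axis4 k : b_AdS (axis v k) (axis4 v) = 0.
Proof. by rewrite b_axis4r (b_AdSC _ (p _)) p_axis axis_w sgn_all_plus; ring. Qed.

Lemma axis4_axis4 : b_AdS (axis4 v) (axis4 v) = -1.
Proof.
rewrite b_axis4r !(b_AdSC (axis4 v)) !b_axis4r (b_AdSC w) p_w w_w b_AdSxx (adm_q hv) /=.
have c2 : cy ^+ 2 = 1 + y ^+ 2 by exact: sqr_sqrt1D.
field: c2; exact: cy_neq0.
Qed.

Lemma col_frame i :
  col i (frame v) = [:: axis0 v; axis v 0; axis v 1; axis v 2; axis4 v]`_i.
Proof. by apply/colP => j; rewrite !mxE. Qed.

Lemma frame_isometry : (frame v)^T *m J_AdS *m frame v = J_AdS.
Proof.
apply/matrixP => i j; rewrite gramE !col_frame !mxE.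
by case: (ord5E i) => [->|[->|[->|[->|->]]]]; case: (ord5E j) => [->|[->|[->|[->|->]]]];
  rewrite /= ?(b_AdSC (axis4 v)) ?(b_AdSC _ (axis0 v)) ?b_axis00 ?b_axis0_axis ?b_axis_axis
    ?axis0_axis4 ?axis_axis4 ?axis4_axis4 //=.
Qed.

Lemma frame_l k s : l k s = frame v *m model y (gen_l k s).
Proof.
rewrite gen_l_model frame_mul !mxE /= l_axisE.
by case: (ord3E k) => [->|[->|->]] /=; rewrite !scale0r !scale1r ?addr0 ?add0r.
Qed.

Lemma frame_p0 : p all_plus = frame v *m model y (gen_p all_plus).
Proof.
have c0 := cy_neq0.
rewrite frame_mul !mxE /= !sigma3 !sgn_all_plus !mulr1 axis4E -/cy /w.
move: (axis0 v) (axis v 0) (axis v 1) (axis v 2) => x0 x1 x2 x3.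
by apply/colP => i; rewrite !mxE /=; field.
Qed.

Lemma m_axis0 e : b_AdS (m e) (axis0 v) = - beta.
Proof.
by apply: (family_axis0 ml) => f i; exact: slope_m_eq.
Qed.

Lemma m_axis (e : signs) k : b_AdS (m e) (axis v k) = beta / Num.sqrt 2 * sgn R (e k).
Proof.
by apply: (family_axis ml) => f i; exact: slope_m_eq.
Qed.

Let delta := beta / Num.sqrt 2.

Lemma betaE : beta = Num.sqrt 2 * delta.
Proof. by rewrite /delta; field; exact: sqrt2_neq0. Qed.

Lemma m_axis4 : b_AdS (m all_plus) (axis4 v) = - (y * delta / cy).
Proof.
(* The last coordinate of m is determined by its orthogonality to p at the same sign vector. *)
rewrite b_axis4r b_AdSC (adm_comm hv); last by rewrite /= card_diff_same.
rewrite b_wr m_axis0 !m_axis !sgn_all_plus -/delta betaE.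
have s2 : Num.sqrt 2 ^+ 2 = 2 :> R := sqr_sqrt2.
by field: s2; exact: cy_neq0.
Qed.

Lemma m_expand : m all_plus =
  frame v *m vec5 beta delta delta delta (y * delta / cy).
Proof.
rewrite {1}(gram_expand (m all_plus) frame_isometry) !col_frame /=.
rewrite !(b_AdSC _ (m all_plus)) m_axis0 !m_axis m_axis4 !sgn_all_plus !mulr1.
by rewrite !opprK.
Qed.

(** The norm of m is delta^2 * (1 - y^2 / cy^2) = delta^2 / cy^2, and it equals 1; positivity of
    delta selects the root. *)
Lemma deltaE : delta = cy.
Proof.
have d0 : 0 < delta by rewrite divr_gt0 ?beta_gt0 ?sqrt2_gt0.
have c2 : cy ^+ 2 = 1 + y ^+ 2 by exact: sqr_sqrt1D.
have s2 : Num.sqrt 2 ^+ 2 = 2 :> R := sqr_sqrt2.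
have c0 : 0 < cy := sqrt1D_gt0 y.
have : q_AdS (m all_plus) = 1 by exact: (adm_q hv).
rewrite m_expand -b_AdSxx b_AdS_gram frame_isometry -b_AdS_mx /b_AdS !mxE /= betaE => h.
have : delta ^+ 2 = cy ^+ 2.
  transitivity (cy ^+ 2 * 1); last by rewrite mulr1.
  rewrite -h; field: c2 s2; exact: cy_neq0.
by move/eqP; rewrite eqrXn2 // ?ltW // => /eqP.
Qed.

Lemma beta_model : beta = Num.sqrt 2 * cy.
Proof. by rewrite betaE deltaE. Qed.

Lemma frame_m0 : m all_plus = frame v *m model y (gen_m all_plus).
Proof.
rewrite m_expand beta_model deltaE mulfK ?cy_neq0 //.
by rewrite /= sigma3 !sgn_all_plus !mulr1.
Qed.

(** Both sides satisfy the same edge relations, so agreement at one vertex spreads over the cube. *)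
Lemma frame_flip (u : signs -> 'cV[R]_5) (g : signs -> gen22) (c : R) :
  u all_plus = frame v *m model y (g all_plus) ->
  (forall e k, u e + u (flip k e) = c *: edge_sum l e k) ->
  (forall e k, model y (g e) + model y (g (flip k e)) = c *: model_edge y e k) ->
  forall e, u e = frame v *m model y (g e).
Proof.
move=> u0 uE gE; apply: flip_ind => // k e IH.
apply: (addrI (u e)); rewrite uE {1}IH -mulmxDr gE -scalemxAr mulmxDr.
by rewrite -!frame_l.
Qed.

Lemma frame_model g : v g = frame v *m model y g.
Proof.
case: g => [e|e|k s]; last exact: frame_l.
  apply: (frame_flip (u := p) frame_p0) => f k; last exact: model_p_flip.
  by rewrite p_edge /alpha param_slope.
apply: (frame_flip (u := m) frame_m0) => f k; last exact: model_m_flip.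
by rewrite m_edge beta_model.
Qed.

End rigidity.

(** * Reflections *)

Section reflections.
Context {R : realType}.
Implicit Types (A B : 'M[R]_5) (X x : 'cV[R]_5) (s : R).

Lemma mulmx_ext A B : (forall x, A *m x = B *m x) -> A = B.
Proof.
move=> AB; apply/matrixP => i j.
have /colP/(_ i) := AB (delta_mx j 0).
by rewrite -!colE !mxE.
Qed.

Lemma b_AdS_isometry B : (forall x, q_AdS (B *m x) = q_AdS x) ->
  forall x y, b_AdS (B *m x) (B *m y) = b_AdS x y.
Proof.
move=> qB x y; have := qB (x + y); rewrite mulmxDr -!b_AdSxx !b_AdSE.
rewrite !b_AdSxx !qB (b_AdSC (B *m y)) (b_AdSC y); lra.
Qed.

Lemma reflectionZ a X : a != 0 -> reflection (a *: X) = reflection X.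
Proof.
move=> a0; apply: mulmx_ext => x; rewrite !reflectionE b_AdSZl q_AdSZ scalerA.
congr (x - _ *: X).
have [->|q0] := eqVneq (q_AdS X) 0; first by rewrite !mulr0 invr0 !mulr0 mul0r.
by field; rewrite q0 a0.
Qed.

Lemma q_reflection X x : q_AdS X != 0 -> q_AdS (reflection X *m x) = q_AdS x.
Proof.
move=> q0; rewrite reflectionE -b_AdSxx !b_AdSE (b_AdSC x X) !b_AdSxx.
by field.
Qed.

Lemma reflectionK X : q_AdS X != 0 -> reflection X *m reflection X = 1%:M.
Proof.
move=> q0; apply: mulmx_ext => x; rewrite mul1mx -mulmxA !reflectionE.
rewrite !b_AdSE b_AdSxx.
by apply/colP => i; rewrite !mxE; field.
Qed.

Lemma reflection_unit X : q_AdS X != 0 -> reflection X \in unitmx.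
Proof. by move=> /reflectionK /mulmx1_unit[]. Qed.

Lemma reflection_comm X Y : b_AdS X Y = 0 ->
  reflection X *m reflection Y = reflection Y *m reflection X.
Proof.
move=> XY; apply: mulmx_ext => x; rewrite -!mulmxA !reflectionE.
rewrite !b_AdSE (b_AdSC Y X) XY !mulr0 !oppr0 !addr0.
by rewrite addrAC.
Qed.

(** If b(X, Y) is not 0, comparing both products on Y gives [reflection Y *m X = - X], so X lies on
    the line negated by [reflection Y]. *)
Lemma reflection_comm_inv X Y : q_AdS X != 0 -> q_AdS Y != 0 ->
  reflection X *m reflection Y = reflection Y *m reflection X ->
  b_AdS X Y = 0 \/ exists c, X = c *: Y.
Proof.
move=> qX qY /(congr1 (mulmx^~ Y)); have [->|XY0] := eqVneq (b_AdS X Y) 0; first by left.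
move=> H; right; exists (b_AdS X Y / q_AdS Y).
move: H; rewrite -!mulmxA.
have [rY _] := (reflectionP (reflection Y) qY).1 erefl.
rewrite rY mulmxN (reflectionE X Y) mulmxDr mulmxN rY -scalemxAr reflectionE (b_AdSC Y X).
set c := 2 * b_AdS X Y / q_AdS X.
have c0 : c != 0 by rewrite mulf_neq0 ?invr_eq0 // mulf_neq0 ?pnatr_eq0.
set d := 2 * b_AdS X Y / q_AdS Y => h.
have {}h : (2 * c) *: X = (c * d) *: Y.
  move: h; move: X Y {qX qY XY0 rY c0} @c @d => X Y c d h.
  by apply/colP => i; have /colP/(_ i) := h; rewrite !mxE; lra.
have c20 : 2 * c != 0 by rewrite mulf_neq0 ?pnatr_eq0.
apply: (scalerI c20); rewrite h scalerA; congr (_ *: _); rewrite /d; ring.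
Qed.

(* For a reflection B, [half_diff X B] is the projection of X to the line
   negated by B, and [normal s X B] the vector on that line with norm s and
   s * b(normal s X B, X) > 0. *)
Definition half_diff X B := 2^-1 *: (X - B *m X).
Definition normal s X B :=
  (Num.sqrt (s * b_AdS (half_diff X B) X))^-1 *: half_diff X B.

Lemma normal_reflection s X Y : s * s = 1 -> q_AdS Y = s -> 0 < s * b_AdS Y X ->
  0 < s * b_AdS (half_diff X (reflection Y)) X /\ normal s X (reflection Y) = Y.
Proof.
move=> ss qY bYX.
have s0 : s != 0 by apply/eqP => s0; move: bYX; rewrite s0 mul0r ltxx.
have sV : s^-1 = s by apply: (mulfI s0); rewrite mulfV.
have hE : half_diff X (reflection Y) = (s * b_AdS Y X) *: Y.
  rewrite /half_diff reflectionE opprB addrC subrK scalerA qY sV; congr (_ *: _).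
  by field.
have nE : s * b_AdS (half_diff X (reflection Y)) X = (s * b_AdS Y X) ^+ 2.
  by rewrite hE b_AdSZl; ring.
rewrite /normal nE sqrtr_sqr gtr0_norm // exprn_gt0 //; split => //.
by rewrite hE scalerA mulVf ?scale1r // lt0r_neq0.
Qed.

(* The invertibility hypothesis makes the (-1)-eigenspace of B a line, since
   on it the matrix agrees with [1 - reflection X], which has rank one. *)
Lemma involution_reflection s X B : s * s = 1 -> q_AdS X = s ->
  (forall x, q_AdS (B *m x) = q_AdS x) -> B *m B = 1%:M ->
  1%:M + B + (1%:M - reflection X) \in unitmx ->
  0 < s * b_AdS (half_diff X B) X ->
  [/\ q_AdS (normal s X B) = s, B = reflection (normal s X B)
    & 0 < s * b_AdS (normal s X B) X].
Proof.
move=> ss qX qB BB; set M := (X in X \in unitmx) => uM n_gt0.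
set w := half_diff X B in n_gt0 *; set n := b_AdS w X in n_gt0 *.
have s0 : s != 0 by apply/eqP => s0; move: n_gt0; rewrite s0 mul0r ltxx.
have n0 : n != 0 by apply/eqP => n0; move: n_gt0; rewrite n0 mulr0 ltxx.
have bB := b_AdS_isometry qB.
have Bsym x y : b_AdS x (B *m y) = b_AdS (B *m x) y.
  by rewrite -{1}(mul1mx x) -BB -mulmxA bB.
set u := invmx M *m X.
have line z : B *m z = - z -> z = (2 * b_AdS X z / s) *: u.
  move=> Bz; rewrite scalemxAr -[LHS](mulKmx uM); congr (_ *m _).
  rewrite /M !mulmxDl mulNmx !mul1mx Bz reflectionE qX subrr add0r.
  by rewrite opprB addrC subrK.
have anti x : B *m (x - B *m x) = - (x - B *m x).
  by rewrite mulmxBr mulmxA BB mul1mx opprB.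
have wE : 2 *: w = X - B *m X.
  by rewrite scalerA mulfV ?scale1r // pnatr_eq0.
have Bw : B *m w = - w by rewrite -scalemxAr anti scalerN.
have wu := line w Bw.
(* Each x - B x lies on the line spanned by u, and B is symmetric for the form, so the coefficient
   depends on x only through b(w, x). *)
have BE x : B *m x = x - (2 * b_AdS w x / n) *: w.
  have := line _ (anti x).
  have -> : b_AdS X (x - B *m x) = 2 * b_AdS w x.
    by rewrite -b_AdSZl wE !b_AdSE Bsym.
  rewrite (b_AdSC X w) -/n in wu => h.
  have -> : B *m x = x - (x - B *m x) by rewrite opprB addrC subrK.
  congr (_ - _); rewrite h wu scalerA; congr (_ *: _).
  by field; rewrite s0 n0.
have w0 : w != 0 by apply/eqP => w0; move: n0; rewrite /n w0 b_AdS0l eqxx.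
have qw : q_AdS w = n.
  have := BE w; rewrite Bw b_AdSxx => h.
  have gen (z : 'cV[R]_5) c : - z = z - c *: z -> (2 - c) *: z = 0.
    by move=> hz; apply/colP => i; have /colP/(_ i) := hz; rewrite !mxE; lra.
  move/gen/eqP: h; rewrite scaler_eq0 (negPf w0) orbF subr_eq0 => /eqP e.
  have : n * 2 = n * (2 * q_AdS w / n) by rewrite -e.
  by rewrite mulrC [RHS]mulrC mulfVK // => /mulfI ->; rewrite ?pnatr_eq0.
have c0 : (Num.sqrt (s * n))^-1 != 0 by rewrite invr_eq0 lt0r_neq0 // sqrtr_gt0.
rewrite /normal -/w -/n; split.
- rewrite q_AdSZ qw exprVn sqr_sqrtr ?ltW // invfM mulfVK //.
  by apply: (mulfI s0); rewrite mulfV.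
- rewrite reflectionZ //; apply: mulmx_ext => x.
  by rewrite reflectionE qw BE.
- by rewrite b_AdSZl -/n mulrCA mulr_gt0 // invr_gt0 sqrtr_gt0.
Qed.

End reflections.

(** * Representations and images of generators *)

Section representations.
Context {R : realType}.
Implicit Types (A : gen22 -> 'M[R]_5).

Record racg_images A : Prop := RacgImages {
  img_isom : forall g, Isom_AdS (A g);
  img_invol : forall g, A g *m A g = 1%:M;
  img_comm : forall g h, commuting22 g h -> A g *m A h = A h *m A g }.

Lemma rep22_images (phi : Gamma22 -> 'M[R]_5) : is_rep22 phi ->
  racg_images (fun g => phi (pres_gen (racg_rels commuting22) g)).
Proof.
move=> [phiI phiM].
pose cls := @pres_class gen22 (racg_rels commuting22).
have clsM u w : phi (cls (u ++ w)) = phi (cls u) *m phi (cls w).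
  by rewrite -phiM; congr phi; rewrite /cls -pres_mulE.
(* Only multiplicativity is assumed of phi; the image of the unit is an invertible idempotent. *)
have phi1 : phi (cls [::]) = 1%:M.
  have [u1 _] := phiI (cls [::]).
  by rewrite -(mulKmx u1 (phi (cls [::]))) -clsM /= mulVmx.
have invol g : phi (cls [:: (g, false)]) *m phi (cls [:: (g, false)]) = 1%:M.
  rewrite -clsM -phi1; congr phi; apply/pres_classP/pres_rel; exact: racg_invol.
have inv g : phi (cls [:: (g, true)]) = phi (cls [:: (g, false)]).
  have : phi (cls [:: (g, false)]) *m phi (cls [:: (g, true)]) = 1%:M.
    rewrite -clsM -phi1; congr phi; apply/pres_classP; exact: pres_cancel.
  by move=> h; rewrite -[LHS]mul1mx -(invol g) -mulmxA h mulmx1.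
split=> [g|g|g h gh].
- exact: phiI.
- exact: invol.
have e : phi (cls [:: (g, false); (h, false); (g, true); (h, true)]) = 1%:M.
  by rewrite -phi1; congr phi; apply/pres_classP/pres_rel; exact: racg_comm.
rewrite (clsM [:: _] [:: _; _; _]) (clsM [:: _] [:: _; _]) (clsM [:: _] [:: _]) in e.
change (phi (cls [:: (g, false)]) *m phi (cls [:: (h, false)])
  = phi (cls [:: (h, false)]) *m phi (cls [:: (g, false)])).
rewrite !inv in e; have := invol g; have := invol h.
move: (phi (cls [:: (g, false)])) (phi (cls [:: (h, false)])) e => a b e bb aa.
rewrite -[RHS]mulmx1 -e -!mulmxA (mulmxA a a) aa mul1mx.
by rewrite (mulmxA b b) bb mul1mx.
Qed.

(** The exponent of a letter is ignored, since generators go to involutions. *)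
Definition eval_word A (w : word gen22) : 'M[R]_5 :=
  foldr (fun l B => A l.1 *m B) 1%:M w.

Lemma eval_word_cat A u w : eval_word A (u ++ w) = eval_word A u *m eval_word A w.
Proof. by elim: u => [|a u IH] /=; rewrite ?mul1mx // IH mulmxA. Qed.

Lemma eval_word_pres A u w : racg_images A ->
  pres_eq (racg_rels commuting22) u w -> eval_word A u = eval_word A w.
Proof.
move=> hA; elim=> {u w} //.
- by move=> u v w _ -> _ ->.
- by move=> u u' v v' _ Eu _ Ev; rewrite !eval_word_cat Eu Ev.
- by move=> i b /=; rewrite mulmx1 (img_invol hA).
move=> w [i|i j ij] /=; rewrite mulmx1 ?(img_invol hA) //.
by rewrite mulmxA {1}(img_comm hA ij) -!mulmxA (mulmxA (A i)) (img_invol hA) mul1mx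
  (img_invol hA).
Qed.

Lemma Isom_AdSM (A B : 'M[R]_5) : Isom_AdS A -> Isom_AdS B -> Isom_AdS (A *m B).
Proof.
move=> [uA qA] [uB qB]; split; first by rewrite unitmx_mul uA.
by move=> x; rewrite -mulmxA qA qB.
Qed.

Lemma images_rep22 A : racg_images A -> Hom22 (coords A).
Proof.
move=> hA; exists (fun x : Gamma22 => eval_word A (repr x)).
  split=> [x|x y].
    elim: (repr x) => [|a w IH] /=; last exact: Isom_AdSM (img_isom hA _) IH.
    by split=> [|z]; rewrite ?unitmx1 ?mul1mx.
  rewrite -eval_word_cat; apply: (eval_word_pres hA); exact: pres_repr_class.
congr coords; apply/funext => g.
rewrite (eval_word_pres hA (pres_repr_class _ _)) /=; exact: mulmx1.
Qed.

Lemma Hom22P (x : 'rV[R]_#|{: gen22 * 'I_5 * 'I_5}|) :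
  Hom22 x <-> exists2 A, racg_images A & x = coords A.
Proof.
split=> [[phi rep <-]|[A hA ->]]; last exact: images_rep22.
by eexists; first exact: rep22_images rep.
Qed.

Definition matrices (x : 'rV[R]_#|{: gen22 * 'I_5 * 'I_5}|) (g : gen22) : 'M[R]_5 :=
  \matrix_(i, j) x 0 (enum_rank (g, i, j)).

Lemma coordsK A g : matrices (coords A) g = A g.
Proof. by apply/matrixP => i j; rewrite !mxE enum_rankK. Qed.

End representations.

(** * Smooth matrix-valued functions *)

Section smooth_matrix.
Context {R : realType} {n : nat}.
Variable U : set 'rV[R]_n.
Hypothesis oU : open U.

Lemma smooth_ext (f g : 'rV[R]_n -> R) : f =1 g -> smooth U f -> smooth U g.
Proof. by move=> /funext ->. Qed.

Lemma smooth_cst (a : R) : smooth U (fun=> a).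
Proof. by move=> k; exact: Ck_cst. Qed.

Lemma smoothD f g : smooth U f -> smooth U g -> smooth U (fun x => f x + g x).
Proof. by move=> sf sg k; apply: CkD. Qed.

Lemma smoothM f g : smooth U f -> smooth U g -> smooth U (fun x => f x * g x).
Proof. by move=> sf sg k; apply: CkM. Qed.

Lemma smoothN f : smooth U f -> smooth U (fun x => - f x).
Proof.
move=> sf; apply: (smooth_ext (f := fun x => -1 * f x)) => [x|].
  by rewrite mulN1r.
by apply: smoothM => //; exact: smooth_cst.
Qed.

Lemma smoothV f : (forall x, U x -> f x != 0) -> smooth U f ->
  smooth U (fun x => (f x)^-1).
Proof. by move=> f0 sf k; apply: CkV. Qed.

Lemma smooth_sqrt f : (forall x, U x -> 0 < f x) -> smooth U f ->
  smooth U (fun x => Num.sqrt (f x)).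
Proof. by move=> f0 sf k; apply: Ck_sqrt. Qed.

Lemma smooth_sum (I : Type) (r : seq I) (P : pred I) (F : I -> 'rV[R]_n -> R) :
  (forall i, smooth U (F i)) -> smooth U (fun x => \sum_(i <- r | P i) F i x).
Proof.
move=> sF; elim: r => [|i r IH].
  by apply: (smooth_ext _ (smooth_cst 0)) => x; rewrite big_nil.
case Pi : (P i); last by apply: smooth_ext IH => x; rewrite big_cons Pi.
by apply: (smooth_ext _ (smoothD (sF i) IH)) => x; rewrite big_cons Pi.
Qed.

Lemma smooth_prod (I : Type) (r : seq I) (P : pred I) (F : I -> 'rV[R]_n -> R) :
  (forall i, smooth U (F i)) -> smooth U (fun x => \prod_(i <- r | P i) F i x).
Proof.
move=> sF; elim: r => [|i r IH].
  by apply: (smooth_ext _ (smooth_cst 1)) => x; rewrite big_nil.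
case Pi : (P i); last by apply: smooth_ext IH => x; rewrite big_cons Pi.
by apply: (smooth_ext _ (smoothM (sF i) IH)) => x; rewrite big_cons Pi.
Qed.

Lemma smooth_sub (V : set 'rV[R]_n) f : V `<=` U -> smooth U f -> smooth V f.
Proof.
move=> VU sf k; elim: k f {sf}(sf k) => [|k IH] f /= cf.
  by move=> x /VU; exact: cf.
by case: cf => df Df; split=> [x /VU|v]; [exact: df|exact: IH].
Qed.

Definition smoothmx p q (F : 'rV[R]_n -> 'M[R]_(p, q)) :=
  forall i j, smooth U (fun x => F x i j).

Lemma smoothmx_cst p q (A : 'M[R]_(p, q)) : smoothmx (fun=> A).
Proof. by move=> i j; exact: smooth_cst. Qed.

Lemma smoothmxD p q (F G : 'rV[R]_n -> 'M[R]_(p, q)) :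
  smoothmx F -> smoothmx G -> smoothmx (fun x => F x + G x).
Proof.
move=> sF sG i j; apply: (smooth_ext _ (smoothD (sF i j) (sG i j))) => x.
by rewrite mxE.
Qed.

Lemma smoothmxN p q (F : 'rV[R]_n -> 'M[R]_(p, q)) :
  smoothmx F -> smoothmx (fun x => - F x).
Proof.
by move=> sF i j; apply: (smooth_ext _ (smoothN (sF i j))) => x; rewrite mxE.
Qed.

Lemma smoothmxB p q (F G : 'rV[R]_n -> 'M[R]_(p, q)) :
  smoothmx F -> smoothmx G -> smoothmx (fun x => F x - G x).
Proof. by move=> sF sG; apply: smoothmxD => //; exact: smoothmxN. Qed.

Lemma smoothmxZ p q f (F : 'rV[R]_n -> 'M[R]_(p, q)) :
  smooth U f -> smoothmx F -> smoothmx (fun x => f x *: F x).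
Proof.
by move=> sf sF i j; apply: (smooth_ext _ (smoothM sf (sF i j))) => x; rewrite mxE.
Qed.

Lemma smoothmxM p q r (F : 'rV[R]_n -> 'M[R]_(p, q)) (G : 'rV[R]_n -> 'M[R]_(q, r)) :
  smoothmx F -> smoothmx G -> smoothmx (fun x => F x *m G x).
Proof.
move=> sF sG i j.
apply: (smooth_ext (f := fun x => \sum_k F x i k * G x k j)) => [x|].
  by rewrite mxE.
by apply: smooth_sum => k; exact: (smoothM (sF i k) (sG k j)).
Qed.

Lemma smooth_det p (F : 'rV[R]_n -> 'M[R]_p) :
  smoothmx F -> smooth U (fun x => \det (F x)).
Proof.
move=> sF; rewrite /determinant; apply: smooth_sum => s.
by apply: smoothM; [exact: smooth_cst|apply: smooth_prod => i; exact: sF].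
Qed.

Lemma smoothmx_inv p (F : 'rV[R]_n -> 'M[R]_p) :
  (forall x, U x -> F x \in unitmx) -> smoothmx F -> smoothmx (fun x => invmx (F x)).
Proof.
move=> uF sF i j k.
(* [invmx] returns a singular matrix unchanged, so the cofactor formula is available on U only. *)
apply: (@eq_Ck _ _ _ _ (fun x => (\det (F x))^-1 * \adj (F x) i j)) => // [x Ux|].
  by rewrite /invmx uF // [RHS]mxE.
move: k; apply: smoothM; first apply: smoothV; last 2 first.
- apply: smooth_det sF.
- apply: (smooth_ext (f := fun x => (-1) ^+ (j + i) *
    \det (row' j (col' i (F x))))) => [x|]; first by rewrite mxE.
  apply: smoothM; first exact: smooth_cst.
  apply: smooth_det => a b.
  by apply: smooth_ext (sF (lift j a) (lift i b)) => x; rewrite !mxE.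
by move=> x /uF; rewrite unitmxE unitfE.
Qed.

Lemma smooth_b_AdS (F G : 'rV[R]_n -> 'cV[R]_5) :
  smoothmx F -> smoothmx G -> smooth U (fun x => b_AdS (F x) (G x)).
Proof.
move=> sF sG; rewrite /b_AdS.
by repeat first [exact: sF|exact: sG|apply: smoothD|apply: smoothN|apply: smoothM].
Qed.

Lemma smoothmx_reflection (F : 'rV[R]_n -> 'cV[R]_5) :
  (forall x, U x -> q_AdS (F x) != 0) -> smoothmx F ->
  smoothmx (fun x => reflection (F x)).
Proof.
move=> qF sF i j.
apply: (smooth_ext (f := fun x => (delta_mx j 0 : 'cV[R]_5) i 0 -
  2 * b_AdS (F x) (delta_mx j 0) * (b_AdS (F x) (F x))^-1 * F x i 0)) => [x|].
  by rewrite b_AdSxx !mxE.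
have sb : smooth U (fun x => b_AdS (F x) (F x)) by exact: smooth_b_AdS.
have sd : smooth U (fun x => b_AdS (F x) (delta_mx j 0)).
  by apply: smooth_b_AdS => //; exact: smoothmx_cst.
apply: smoothD; first exact: smooth_cst.
apply/smoothN/smoothM => //; apply: smoothM.
  by apply: smoothM => //; exact: smooth_cst.
by apply: smoothV => // x Ux; rewrite b_AdSxx qF.
Qed.

Lemma near_gt0 f x : smooth U f -> U x -> 0 < f x -> \forall y \near x, 0 < f y.
Proof. by move=> sf Ux h; have := sf 0%N x Ux => /cvgr_gt; apply. Qed.

Lemma near_lt0 f x : smooth U f -> U x -> f x < 0 -> \forall y \near x, f y < 0.
Proof. by move=> sf Ux h; have := sf 0%N x Ux => /cvgr_lt; apply. Qed.

Lemma near_neq0 f x : smooth U f -> U x -> f x != 0 -> \forall y \near x, f y != 0.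
Proof.
move=> sf Ux; rewrite neq_lt => /orP[] h.
  by apply: filterS (near_lt0 sf Ux h) => y; exact: ltr0_neq0.
by apply: filterS (near_gt0 sf Ux h) => y; exact: lt0r_neq0.
Qed.

Lemma near_ltr f g x : smooth U f -> smooth U g -> U x -> f x < g x ->
  \forall y \near x, f y < g y.
Proof.
move=> sf sg Ux fg; have := near_gt0 (smoothD sg (smoothN sf)) Ux.
by rewrite subr_gt0 => /(_ fg); apply: filterS => y; rewrite subr_gt0.
Qed.

End smooth_matrix.

(** * The model satisfies the relations and the open conditions *)

Section model_facts.
Context {R : realType}.
Implicit Types (v : gen22 -> 'cV[R]_5) (y : R).

Lemma f_AdS_model (t : R) g : -1 < t < 1 ->
  f_AdS t g = model (t / Num.sqrt (1 - t ^+ 2)) g.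
Proof.
move=> /andP[t1 t2]; have D0 : 0 < 1 - t ^+ 2 by nra.
set D := Num.sqrt (1 - t ^+ 2).
have Dp : 0 < D by rewrite sqrtr_gt0.
have D2 : D ^+ 2 = 1 - t ^+ 2 by rewrite sqr_sqrtr // ltW.
have D0' : D != 0 by rewrite lt0r_neq0.
have cE : Num.sqrt (1 + (t / D) ^+ 2) = D^-1.
  rewrite -[RHS]gtr0_norm ?invr_gt0 // -sqrtr_sqr; congr Num.sqrt.
  by field: D2.
case: g => [e|e|k s] //=; rewrite cE -?/D; apply/colP => i; rewrite !mxE;
  by case: (ord5E i) => [->|[->|[->|[->|->]]]] /=; field.
Qed.

Lemma flip_or_same (e d : signs) : (#|[set k | e k != d k]%SET| <= 1)%N ->
  d = e \/ exists k, d = flip k e.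
Proof.
rewrite leq_eqVlt ltnS leqn0 cards_eq0 => /orP[/cards1P[k ek]|/eqP ed].
  right; exists k; apply/ffunP => i; rewrite ffunE.
  have : (i \in [set k | e k != d k]%SET) = (i == k) by rewrite ek finset.in_set1.
  rewrite inE => <-.
  by case: (e i); case: (d i).
left; apply/ffunP => i.
have : (i \in [set k | e k != d k]%SET) = false by rewrite ed finset.in_set0.
by rewrite inE => /negbFE/eqP.
Qed.

Lemma q_model y g : q_AdS (model y g) = qsign g.
Proof.
have c2 := sqr_sqrt1D y; have s2 := sqr_sqrt2 (R := R).
have S b := sgn2 (R := R) b.
case: g => [e|e|k s].
- have h0 := S (e 0); have h1 := S (e 1); have h2 := S (e 2).
  by rewrite /q_AdS /= !mxE /= sigma3; ring: c2 s2 h0 h1 h2.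
- have h0 := S (e 0); have h1 := S (e 1); have h2 := S (e 2).
  by rewrite /q_AdS /= !mxE /= sigma3; ring: c2 s2 h0 h1 h2.
have h0 := S s; rewrite gen_l_model /q_AdS !mxE /=.
by case: (ord3E k) => [->|[->|->]] /=; ring: s2 h0.
Qed.

Lemma model_comm y g h : commuting22 g h -> b_AdS (model y g) (model y h) = 0.
Proof.
have c2 := sqr_sqrt1D y; have s2 := sqr_sqrt2 (R := R).
have S b := sgn2 (R := R) b.
case: g => [e|e|k s]; case: h => [d|d|k' s'] //=.
- have h0 := S (e 0); have h1 := S (e 1); have h2 := S (e 2).
  case/flip_or_same => [->|[k ->]].
    by rewrite /b_AdS /= !mxE /= sigma3; ring: c2 s2 h0 h1 h2.
  rewrite /b_AdS /= !mxE /= sigma_flip !ffunE sigma3.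
  by case: (ord3E k) => [->|[->|->]] /=; rewrite ?addbT ?addbF ?sgnN;
    ring: c2 s2 h0 h1 h2.
- move=> /eqP <-; have h0 := S (e k').
  rewrite -/(model y (gen_l k' (e k'))) gen_l_model /b_AdS !mxE /=; move: h0.
  by case: (ord3E k') => [->|[->|->]] /= h0; ring: s2 h0.
- move=> /eqP <-; have h0 := S (e k').
  rewrite -/(model y (gen_l k' (e k'))) gen_l_model /b_AdS !mxE /=; move: h0.
  by case: (ord3E k') => [->|[->|->]] /= h0; ring: s2 h0.
Qed.

Lemma inord123 : ((inord (0%R : 'I_3).+1 = 1%R :> 'I_5) *
  (inord (1%R : 'I_3).+1 = 2%R :> 'I_5) * (inord (2%R : 'I_3).+1 = 3%R :> 'I_5))%type.
Proof. by do !split; apply: val_inj; rewrite /= inordK. Qed.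

Lemma in_position_model y : y != 0 -> in_position (model y).
Proof.
move=> y0; have c2 := sqr_sqrt1D y; have s2 := sqr_sqrt2 (R := R).
have S b := sgn2 (R := R) b.
have c0 := sqrt1D_gt0 y; have s0 := sqrt2_gt0 (R := R).
have s1 : 1 < Num.sqrt 2 :> R by nra.
split.
- move=> i j s s'; rewrite !gen_l_model /b_AdS !mxE /=.
  by case: (ord3E i) => [->|[->|->]]; case: (ord3E j) => [->|[->|->]] //= _;
    rewrite ?(mul0r, mulr0); lra.
- move=> e k; have h0 := S (e 0); have h1 := S (e 1); have h2 := S (e 2).
  rewrite [X in _ < X](_ : _ = 1) ?ltr01 //.
  rewrite /b_AdS /= !mxE /= sigma_flip !ffunE sigma3.
  by case: (ord3E k) => [->|[->|->]] /=; rewrite ?addbT ?addbF ?sgnN;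
    ring: c2 s2 h0 h1 h2.
- move=> e k; have h0 := S (e 0); have h1 := S (e 1); have h2 := S (e 2).
  rewrite [X in X < _](_ : _ = -1) ?ltrN10 //.
  rewrite /b_AdS /= !mxE /= sigma_flip !ffunE sigma3.
  by case: (ord3E k) => [->|[->|->]] /=; rewrite ?addbT ?addbF ?sgnN;
    ring: c2 s2 h0 h1 h2.
(* The sum is twice sqrt 2 * y: this is where y must be nonzero. *)
- move=> e k; rewrite /= !mxE /= -mulr2n mulrn_eq0 /= mulf_neq0 //.
- by move=> e; rewrite /= !mxE /= mulr_gt0.
- by move=> k s; rewrite gen_l_model !mxE /=.
- move=> e k; have h0 := S (e k); move: h0.
  by case: (ord3E k) => [->|[->|->]] h0; rewrite inord123 /= !mxE /=;
    rewrite mulrCA h0 mulr1 ltr_pMl.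
move=> k s; have h0 := S s; rewrite gen_l_model.
by case: (ord3E k) => [->|[->|->]]; rewrite inord123 !mxE /= mulrA h0 mul1r.
Qed.

Lemma param_model y : param (model y) = y.
Proof.
rewrite /param /axis0 !gen_l_model /b_AdS /= !mxE /=.
by rewrite /sgn /= expr0 expr1; field; exact: sqrt2_neq0.
Qed.

(** With [frame_equivariant], this recovers the isometry A as the frame of the vectors
    [A *m model y g]. *)
Lemma frame_model1 y : frame (model y) = 1%:M.
Proof.
have s0 := sqrt2_neq0 (R := R).
have a0 : axis0 (model y) = vec5 1 0 0 0 0.
  apply/colP => i; rewrite /axis0 !gen_l_model !mxE.
  by case: (ord5E i) => [->|[->|[->|[->|->]]]] /=; rewrite /sgn /=; field.
have a k : axis (model y) k =
    vec5 0 (k == 0)%:R (k == 1)%:R (k == 2)%:R 0.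
  apply/colP => i; rewrite /axis !gen_l_model !mxE.
  by case: (ord3E k) => [->|[->|->]]; case: (ord5E i) => [->|[->|[->|[->|->]]]] /=;
    rewrite /sgn /=; field.
have c0 := lt0r_neq0 (sqrt1D_gt0 y).
have a4 : axis4 (model y) = vec5 0 0 0 0 1.
  apply/colP => i; rewrite /axis4 param_model a0 !a /= !sigma3 !sgn_all_plus !mxE.
  by case: (ord5E i) => [->|[->|[->|[->|->]]]] /=; field.
apply/matrixP => i j; rewrite !mxE a0 !a a4.
by case: (ord5E j) => [->|[->|[->|[->|->]]]] /=; rewrite !mxE;
  case: (ord5E i) => [->|[->|[->|[->|->]]]].
Qed.

Lemma frame_equivariant (A : 'M[R]_5) v :
  (forall x z : 'cV[R]_5, b_AdS (A *m x) (A *m z) = b_AdS x z) ->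
  param (fun g => A *m v g) = param v /\
  frame (fun g => A *m v g) = A *m frame v.
Proof.
move=> bA.
have a0 : axis0 (fun g => A *m v g) = A *m axis0 v.
  by rewrite /axis0 -scalemxAr mulmxDr.
have a k : axis (fun g => A *m v g) k = A *m axis v k.
  by rewrite /axis -scalemxAr mulmxBr.
have pE : param (fun g => A *m v g) = param v by rewrite /param a0 bA.
have a4 : axis4 (fun g => A *m v g) = A *m axis4 v.
  rewrite /axis4 pE a0 !a.
  move: (axis0 v) (axis v 0) (axis v 1) (axis v 2) (param v) => x0 x1 x2 x3 y.
  by rewrite -scalemxAr mulmxBr -scalemxAr !mulmxDr -scalemxAr.
split=> //; apply/matrixP => i j; rewrite !mxE.
have -> : \sum_k A i k * frame v k j =
    (A *m [:: axis0 v; axis v 0; axis v 1; axis v 2; axis4 v]`_j) i 0.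
  by rewrite mxE; apply: eq_bigr => k _; rewrite mxE.
by rewrite a0 !a a4; case: (ord5E j) => [->|[->|[->|[->|->]]]].
Qed.

End model_facts.

(** * Cayley transform *)

Section cayley.
Context {R : realType}.
Implicit Types (Z A K : 'M[R]_5).

(** In this normalisation the transform is its own inverse, so one formula leads from the isometry
    group to its Lie algebra (the Z with [J_AdS *m Z] skew) and back. *)
Definition cayley Z := (1%:M - Z) *m invmx (1%:M + Z).

Lemma cayley_mul Z : 1%:M + Z \in unitmx -> cayley Z *m (1%:M + Z) = 1%:M - Z.
Proof. by move=> uZ; rewrite mulmxKV. Qed.

Lemma tr_1D Z : (1%:M + Z)^T = 1%:M + Z^T.
Proof. by rewrite linearD /= trmx1. Qed.

Lemma tr_1B Z : (1%:M - Z)^T = 1%:M - Z^T.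
Proof. by rewrite linearB /= trmx1. Qed.

Lemma cayleyK Z : 1%:M + Z \in unitmx ->
  1%:M + cayley Z \in unitmx /\ cayley (cayley Z) = Z.
Proof.
move=> uZ; have cZ := cayley_mul uZ; set A := cayley Z in cZ *.
have AE : (1%:M + A) *m (1%:M + Z) = 2%:M.
  rewrite mulmxDl mul1mx cZ addrACA subrr addr0.
  by apply/matrixP => i j; rewrite !mxE; case: eqP => _; rewrite ?mulr1n ?mulr0n ?addr0.
have AE' : (1%:M - A) *m (1%:M + Z) = 2 *: Z.
  rewrite mulmxBl mul1mx cZ opprB addrC addrA subrK.
  by rewrite scaler_nat mulr2n.
have uA : 1%:M + A \in unitmx.
  have : (1%:M + A) *m (2^-1 *: (1%:M + Z)) = 1%:M.
    rewrite -scalemxAr AE; apply/matrixP => i j; rewrite !mxE.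
    by case: eqP => _; rewrite ?mulr1n ?mulr0n ?mulVf ?mulr0 ?pnatr_eq0.
  by move/mulmx1_unit => [].
split=> //.
suff h : 1%:M - A = Z *m (1%:M + A) by rewrite /cayley h mulmxK.
rewrite -[LHS](mulmxK uZ) AE' -[RHS](mulmxK uZ); congr (_ *m _).
by rewrite -mulmxA AE mul_mx_scalar.
Qed.

(** With denominators cleared, the claim is (1 - Z)^T J (1 - Z) = (1 + Z)^T J (1 + Z); since Z^T J =
    - J Z, both sides are J - J Z Z. *)
Lemma cayley_isometry Z : 1%:M + Z \in unitmx ->
  (J_AdS *m Z)^T = - (J_AdS *m Z) ->
  (cayley Z)^T *m J_AdS *m cayley Z = J_AdS.
Proof.
move=> uZ; rewrite trmx_mul tr_J_AdS => sk.
have cZ := cayley_mul uZ.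
have uZ' : (1%:M + Z)^T \in unitmx by rewrite unitmx_tr.
rewrite -[LHS](mulmxK uZ) -[RHS](mulmxK uZ); congr (_ *m _).
rewrite -[LHS](mulKmx uZ') -[RHS](mulKmx uZ'); congr (_ *m _).
have -> : (1%:M + Z)^T *m ((cayley Z)^T *m J_AdS *m cayley Z *m (1%:M + Z)) =
    (cayley Z *m (1%:M + Z))^T *m J_AdS *m (cayley Z *m (1%:M + Z)).
  by rewrite (trmx_mul (cayley Z)) !mulmxA.
rewrite cZ tr_1B tr_1D !(mulmxBl, mulmxBr, mulmxDl, mulmxDr) !mul1mx !mulmx1.
rewrite !(mulNmx, mulmxN) !mulmxA sk !(mulNmx, mulmxN).
move: (J_AdS *m Z *m Z) (J_AdS *m Z) J_AdS => a b c.
by apply/matrixP => i j; rewrite !mxE; lra.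
Qed.

Lemma cayley_skew A : A^T *m J_AdS *m A = J_AdS -> 1%:M + A \in unitmx ->
  (J_AdS *m cayley A)^T = - (J_AdS *m cayley A).
Proof.
move=> AJ uA; have cA := cayley_mul uA.
set Z := cayley A in cA *.
have uA' : (1%:M + A)^T \in unitmx by rewrite unitmx_tr.
rewrite trmx_mul tr_J_AdS.
rewrite -[LHS](mulmxK uA) -[RHS](mulmxK uA); congr (_ *m _).
rewrite -[LHS](mulKmx uA') -[RHS](mulKmx uA'); congr (_ *m _).
have -> : (1%:M + A)^T *m (Z^T *m J_AdS *m (1%:M + A)) =
    (Z *m (1%:M + A))^T *m J_AdS *m (1%:M + A) by rewrite (trmx_mul Z) !mulmxA.
rewrite mulNmx mulmxN -(mulmxA J_AdS Z) cA tr_1B tr_1D.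
rewrite !(mulmxBl, mulmxBr, mulmxDl, mulmxDr) !mul1mx !mulmx1.
rewrite !(mulNmx, mulmxN) !mulmxA AJ.
move: (A^T *m J_AdS) (J_AdS *m A) J_AdS => a b c.
by apply/matrixP => i j; rewrite !mxE; lra.
Qed.

End cayley.

(** * Coordinates on skew matrices *)

Section skew_coordinates.
Context {R : realType}.

(* The entries above the diagonal are listed column by column, the entry
   (i, j) at position 'C(j, 2) + i; the last coordinate is free. *)
Definition row_index : seq 'I_5 := [:: 0; 0; 1; 0; 1; 2; 0; 1; 2; 3].
Definition col_index : seq 'I_5 := [:: 1; 2; 2; 3; 3; 3; 4; 4; 4; 4].

Definition skew_mx (r : 'rV[R]_11) : 'M[R]_5 := \matrix_(i, j)
  if (i < j)%N then r 0 (inord ('C(j, 2) + i))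
  else if (j < i)%N then - r 0 (inord ('C(i, 2) + j)) else 0.

Definition skew_coords (K : 'M[R]_5) (y : R) : 'rV[R]_11 := \row_n
  if n == 10 :> nat then y else K (nth 0 row_index n) (nth 0 col_index n).

Lemma skew_mx_tr r : (skew_mx r)^T = - skew_mx r.
Proof. by apply/matrixP => i j; rewrite !mxE; case: ltngtP; rewrite ?opprK ?oppr0. Qed.

Lemma skew_coordsK K y : K^T = - K -> skew_mx (skew_coords K y) = K /\ skew_coords K y 0 (inord 10) = y.
Proof.
move=> sk; have skE i j : K i j = - K j i.
  by move/matrixP: sk => /(_ j i); rewrite !mxE.
have sk0 i : K i i = 0 by have := skE i i; lra.
split; last by rewrite mxE inordK.
apply/matrixP => i j; rewrite mxE.
by case: (ord5E i) => [->|[->|[->|[->|->]]]]; case: (ord5E j) => [->|[->|[->|[->|->]]]];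
  rewrite /= ?mxE ?inordK //= ?sk0 // -skE.
Qed.

Lemma skew_mxK r : skew_coords (skew_mx r) (r 0 (inord 10)) = r.
Proof.
apply/rowP => n; rewrite mxE.
have rE m (h : m = n :> nat) : r 0 (inord m) = r 0 n.
  by congr (r 0 _); apply: val_inj; rewrite /= h inordK.
case: eqP => [n10|]; first exact: rE.
case: n rE => [[|[|[|[|[|[|[|[|[|[|[|m]]]]]]]]]]] hn] // rE _;
  by rewrite mxE /= rE.
Qed.

End skew_coordinates.

(** * The chart *)

Section frame_smooth.
Context {R : realType} {n : nat}.
Variable U : set 'rV[R]_n.
Hypothesis oU : open U.
Variable v : 'rV[R]_n -> gen22 -> 'cV[R]_5.
Hypothesis sv : forall g, smoothmx U (fun x => v x g).

Lemma smooth_axis0 : smoothmx U (fun x => axis0 (v x)).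
Proof. by apply: smoothmxZ; [|exact: smooth_cst|apply: smoothmxD]. Qed.

Lemma smooth_axis k : smoothmx U (fun x => axis (v x) k).
Proof. by apply: smoothmxZ; [|exact: smooth_cst|apply: smoothmxB]. Qed.

Lemma smooth_param : smooth U (fun x => param (v x)).
Proof.
apply: smoothM => //; last exact: smooth_cst.
by apply: smoothN => //; apply: smooth_b_AdS => //; exact: smooth_axis0.
Qed.

Lemma smooth_sqrt1D f : smooth U f -> smooth U (fun x => Num.sqrt (1 + f x ^+ 2)).
Proof.
move=> sf; apply: smooth_sqrt => // [x _|]; first by rewrite ltr_pwDl // sqr_ge0.
apply: smoothD => //; first exact: smooth_cst.
by apply: (smooth_ext (f := fun x => f x * f x)) => //; apply: smoothM.
Qed.

Lemma smooth_axis4 : smoothmx U (fun x => axis4 (v x)).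
Proof.
apply: smoothmxZ => //.
  apply: smoothV => // [x _|]; first by rewrite lt0r_neq0 // sqrt1D_gt0.
  exact: smooth_sqrt1D smooth_param.
apply: smoothmxB => //; apply: smoothmxZ => //; first exact: smooth_param.
do 3 (apply: smoothmxD => //; last exact: smooth_axis).
by apply: smoothmxZ => //; [exact: smooth_cst|exact: smooth_axis0].
Qed.

Lemma smooth_frame : smoothmx U (fun x => frame (v x)).
Proof.
move=> i j; apply: (smooth_ext (f := fun x =>
  [:: axis0 (v x); axis (v x) 0; axis (v x) 1; axis (v x) 2; axis4 (v x)]`_j i 0)).
  by move=> x; rewrite mxE.
case: (ord5E j) => [->|[->|[->|[->|->]]]] /=;
  [exact: smooth_axis0|exact: smooth_axis|exact: smooth_axis|exact: smooth_axis|
   exact: smooth_axis4].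
Qed.

End frame_smooth.

Lemma near_forall (T : topologicalType) (I : finType) (P : I -> T -> Prop) (x : T) :
  (forall i, \forall y \near x, P i y) -> \forall y \near x, forall i, P i y.
Proof. exact: (@filter_forall T I P _ (nbhs_filter x)). Qed.

Lemma near_preimage (T T' : topologicalType) (f : T -> T') (x : T) (P : T' -> Prop) :
  {for x, continuous f} -> (\forall y \near f x, P y) -> \forall z \near x, P (f z).
Proof. by move=> cf /cf. Qed.

Lemma qsign2 {R : realType} g : qsign g * qsign g = 1 :> R.
Proof. by case: g => *; rewrite /qsign ?mulrNN mulr1. Qed.

Lemma qsign_neq0 {R : realType} g : qsign g != 0 :> R.
Proof. by case: g => *; rewrite ?oppr_eq0 oner_eq0. Qed.

Lemma reflection_images (R : realType) (v : gen22 -> 'cV[R]_5) :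
  (forall g, q_AdS (v g) = qsign g) ->
  (forall g h, commuting22 g h -> b_AdS (v g) (v h) = 0) ->
  racg_images (fun g => reflection (v g)).
Proof.
move=> qv cv; have q0 g : q_AdS (v g) != 0 by rewrite qv qsign_neq0.
split=> [g|g|g h gh].
- by split; [exact: reflection_unit|move=> x; exact: q_reflection].
- exact: reflectionK.
- by apply: reflection_comm; exact: cv.
Qed.

Section chart.
Context {R : realType}.
Variable y0 : R.

Local Notation N := #|{: gen22 * 'I_5 * 'I_5}|.
Local Notation X0 := (model y0).

Definition normals (x : 'rV[R]_N) (g : gen22) :=
  normal (qsign g) (X0 g) (matrices x g).

Definition normals_dom : set 'rV[R]_N :=
  [set x | forall g,
    0 < qsign g * b_AdS (half_diff (X0 g) (matrices x g)) (X0 g)].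

(** The first clause makes [normals] smooth, the second lets [involution_reflection] apply, the
    third feeds the rigidity argument and the last makes the Cayley transform of the frame
    available. *)
Definition nbhd : set 'rV[R]_N :=
  [set x | [/\ normals_dom x,
    forall g, 1%:M + matrices x g + (1%:M - reflection (X0 g)) \in unitmx,
    in_position (normals x) & 1%:M + frame (normals x) \in unitmx]].

Definition to_param (x : 'rV[R]_N) : 'rV[R]_11 :=
  skew_coords (J_AdS *m cayley (frame (normals x))) (param (normals x)).

Definition rotation (r : 'rV[R]_11) : 'M[R]_5 := cayley (J_AdS *m skew_mx r).

Definition moved (r : 'rV[R]_11) (g : gen22) :=
  rotation r *m model (r 0 (inord 10)) g.

Definition of_param (r : 'rV[R]_11) : 'rV[R]_N :=
  coords (fun g => reflection (moved r g)).

Definition cayley_dom : set 'rV[R]_11 :=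
  [set r | 1%:M + J_AdS *m skew_mx r \in unitmx].

(** Positivity selects [moved r] among the normals up to sign. The last clause makes [of_param] land
    in [nbhd] by definition; it is open by continuity of [of_param]. *)
Definition param_dom : set 'rV[R]_11 :=
  [set r | [/\ cayley_dom r,
    forall g, 0 < qsign g * b_AdS (moved r g) (X0 g) & nbhd (of_param r)]].

Lemma smooth_matrices (U : set 'rV[R]_N) g : smoothmx U (fun x => matrices x g).
Proof.
move=> i j; apply: (smooth_ext (f := fun x => x 0 (enum_rank (g, i, j)))) => [x|].
  by rewrite mxE.
by move=> k; exact: Ck_coord.
Qed.

Lemma smooth_half_diff (U : set 'rV[R]_N) g : open U ->
  smoothmx U (fun x => half_diff (X0 g) (matrices x g)).
Proof.
move=> oU; apply: smoothmxZ => //; first exact: smooth_cst.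
apply: smoothmxB => //; first exact: smoothmx_cst.
by apply: smoothmxM => //; [exact: smooth_matrices|exact: smoothmx_cst].
Qed.

Lemma smooth_normals_form (U : set 'rV[R]_N) g : open U ->
  smooth U (fun x => qsign g * b_AdS (half_diff (X0 g) (matrices x g)) (X0 g)).
Proof.
move=> oU; apply: smoothM => //; first exact: smooth_cst.
by apply: smooth_b_AdS => //; [exact: smooth_half_diff|exact: smoothmx_cst].
Qed.

Lemma open_normals_dom : open normals_dom.
Proof.
rewrite openE => x xD.
suff h : \forall y \near x, forall g,
    0 < qsign g * b_AdS (half_diff (X0 g) (matrices y g)) (X0 g) by exact: h.
apply: near_forall => g.
exact: (near_gt0 (smooth_normals_form g openT) I (xD g)).
Qed.

Lemma smooth_normals g : smoothmx normals_dom (fun x => normals x g).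
Proof.
have oD := open_normals_dom.
apply: smoothmxZ => //; last exact: smooth_half_diff.
apply: smoothV => // [x xD|]; first by rewrite lt0r_neq0 // sqrtr_gt0.
by apply: smooth_sqrt => //; exact: smooth_normals_form.
Qed.

Lemma near_unitmx n p (U : set 'rV[R]_n) (F : 'rV[R]_n -> 'M[R]_p) x :
  open U -> smoothmx U F -> U x -> F x \in unitmx -> \forall y \near x, F y \in unitmx.
Proof.
move=> oU sF Ux; rewrite unitmxE unitfE => dF.
apply: filterS (near_neq0 (smooth_det oU sF) Ux dF) => y.
by rewrite unitmxE unitfE.
Qed.

Lemma open_nbhd : open nbhd.
Proof.
have oD := open_normals_dom; have sn g := smooth_normals g.
rewrite openE => x [xD xu [ll pp mm p0 m0 l0 mk lk] xf].
have xDn := open_near oD xD.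
have sb g h : smooth normals_dom (fun x => b_AdS (normals x g) (normals x h)).
  exact: smooth_b_AdS.
have sc (a : R) : smooth normals_dom (fun=> a) by exact: smooth_cst.
have u1 : \forall y \near x, forall g,
    1%:M + matrices y g + (1%:M - reflection (X0 g)) \in unitmx.
  apply: near_forall => g; apply: (near_unitmx oD _ xD (xu g)).
  apply: smoothmxD; [exact: oD| |exact: smoothmx_cst].
  by apply: smoothmxD; [exact: oD|exact: smoothmx_cst|exact: smooth_matrices].
have u2 : \forall y \near x, 1%:M + frame (normals y) \in unitmx.
  apply: (near_unitmx oD _ xD xf).
  by apply: smoothmxD; [exact: oD|exact: smoothmx_cst|exact: smooth_frame].
have c1 : \forall y \near x, forall i j s s', i != j ->
    b_AdS (normals y (gen_l i s)) (normals y (gen_l j s')) < 0.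
  apply: near_forall => i; apply: near_forall => j.
  apply: near_forall => s; apply: near_forall => s'.
  have [->|ij] := eqVneq i j; first by apply: filterS xDn => y.
  by apply: filterS (near_lt0 (sb _ _) xD (ll _ _ s s' ij)) => y ?.
have c2 : \forall y \near x, forall e k,
    0 < b_AdS (normals y (gen_p e)) (normals y (gen_p (flip k e))).
  by do 2 (apply: near_forall => ?); apply: near_gt0.
have c3 : \forall y \near x, forall e k,
    b_AdS (normals y (gen_m e)) (normals y (gen_m (flip k e))) < 0.
  by do 2 (apply: near_forall => ?); apply: near_lt0.
have c4 : \forall y \near x, forall e k,
    normals y (gen_p e) 0 0 + normals y (gen_p (flip k e)) 0 0 != 0.
  do 2 (apply: near_forall => ?).
  by apply: (near_neq0 (smoothD oD (sn _ 0 0) (sn _ 0 0)) xD (p0 _ _)).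
have c5 : \forall y \near x, forall e, 0 < normals y (gen_m e) 0 0.
  by apply: near_forall => ?; apply: (near_gt0 (sn _ 0 0) xD).
have c6 : \forall y \near x, forall k s, 0 < normals y (gen_l k s) 0 0.
  by do 2 (apply: near_forall => ?); apply: (near_gt0 (sn _ 0 0) xD).
have c7 : \forall y \near x, forall (e : signs) k,
    sgn R (e k) * normals y (gen_m e) (inord k.+1) 0 < normals y (gen_m e) 0 0.
  do 2 (apply: near_forall => ?).
  exact: (near_ltr oD (smoothM oD (sc _) (sn _ _ 0)) (sn _ 0 0) xD (mk _ _)).
have c8 : \forall y \near x, forall k s,
    normals y (gen_l k s) 0 0 < sgn R s * normals y (gen_l k s) (inord k.+1) 0.
  do 2 (apply: near_forall => ?).
  exact: (near_ltr oD (sn _ 0 0) (smoothM oD (sc _) (sn _ _ 0)) xD (lk _ _)).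
near=> y; split.
- by near: y.
- by near: y.
- by split; near: y.
- by near: y.
Unshelve. all: by end_near. Qed.

Lemma smooth_skew_mx (U : set 'rV[R]_11) : open U -> smoothmx U (@skew_mx R).
Proof.
move=> oU i j; have sc k : smooth U (fun r => r 0 k) by move=> m; exact: Ck_coord.
apply: (smooth_ext (f := fun r : 'rV[R]_11 =>
  if (i < j)%N then r 0 (inord ('C(j, 2) + i))
  else if (j < i)%N then - r 0 (inord ('C(i, 2) + j)) else 0)) => [r|].
  by rewrite mxE.
case: (i < j)%N; first exact: sc.
by case: (j < i)%N; [apply: smoothN|exact: smooth_cst].
Qed.

Lemma smooth_cayley_den (U : set 'rV[R]_11) : open U ->
  smoothmx U (fun r => 1%:M + J_AdS *m skew_mx r).
Proof.
move=> oU; apply: smoothmxD; [exact: oU|exact: smoothmx_cst|].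
by apply: smoothmxM; [exact: oU|exact: smoothmx_cst|exact: smooth_skew_mx].
Qed.

Lemma open_cayley_dom : open cayley_dom.
Proof.
rewrite openE => r rD.
exact: (near_unitmx openT (smooth_cayley_den openT) I rD).
Qed.

Lemma smooth_moved g : smoothmx cayley_dom (fun r => moved r g).
Proof.
have oD := open_cayley_dom.
have sy : smooth cayley_dom (fun r : 'rV[R]_11 => r 0 (inord 10)).
  by move=> m; exact: Ck_coord.
apply: smoothmxM; first exact: oD.
  apply: smoothmxM; first exact: oD.
    apply: smoothmxB; [exact: oD|exact: smoothmx_cst|].
    by apply: smoothmxM; [exact: oD|exact: smoothmx_cst|exact: smooth_skew_mx].
  by apply: smoothmx_inv; [exact: oD| |exact: smooth_cayley_den].
have sc := smooth_sqrt1D oD sy.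
have scst (a : R) : smooth cayley_dom (fun=> a) by exact: smooth_cst.
have svec (f0 f1 f2 f3 f4 : 'rV[R]_11 -> R) :
    smooth cayley_dom f0 -> smooth cayley_dom f1 -> smooth cayley_dom f2 ->
    smooth cayley_dom f3 -> smooth cayley_dom f4 ->
    smoothmx cayley_dom (fun r => vec5 (f0 r) (f1 r) (f2 r) (f3 r) (f4 r)).
  move=> h0 h1 h2 h3 h4 i j.
  apply: (smooth_ext (f := fun r => [:: f0 r; f1 r; f2 r; f3 r; f4 r]`_i)) => [r|].
    by rewrite mxE.
  by case: (ord5E i) => [->|[->|[->|[->|->]]]].
case: g => [e|e|k s]; last exact: smoothmx_cst.
  by apply: svec; apply: smoothM.
by apply: svec; apply: smoothM.
Qed.

Lemma moved_isometry r : cayley_dom r ->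
  (rotation r)^T *m J_AdS *m rotation r = J_AdS.
Proof.
move=> rD; apply: cayley_isometry => //.
by rewrite mulmxA J_AdSK mul1mx skew_mx_tr.
Qed.

Lemma b_moved r : cayley_dom r -> forall x y,
  b_AdS (rotation r *m x) (rotation r *m y) = b_AdS x y.
Proof. by move=> rD x y; rewrite b_AdS_gram moved_isometry // -b_AdS_mx. Qed.

Lemma q_moved r g : cayley_dom r -> q_AdS (moved r g) = qsign g.
Proof. by move=> rD; rewrite -b_AdSxx b_moved // b_AdSxx q_model. Qed.

Lemma smooth_of_param : smooth_on_open cayley_dom of_param.
Proof.
move=> k; apply: Ck_on_row => [|l]; first exact: open_cayley_dom.
have sr (c : gen22 * 'I_5 * 'I_5) : smooth cayley_dom
    (fun r => let: (g, i, j) := c in reflection (moved r g) i j).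
  case: c => [[g i] j]; apply: smoothmx_reflection; first exact: open_cayley_dom.
    by move=> r rD; rewrite q_moved // qsign_neq0.
  exact: smooth_moved.
by apply: (smooth_ext _ (sr (enum_val l))) => r; rewrite mxE.
Qed.

Lemma smooth_to_param : smooth_on_open nbhd to_param.
Proof.
move=> k; apply: Ck_on_row => [|l]; first exact: open_nbhd.
have oN := open_nbhd.
have sn g : smoothmx nbhd (fun x => normals x g).
  by move=> i j; apply: smooth_sub (smooth_normals g i j) => x [].
have sf := smooth_frame oN sn.
have sK : smoothmx nbhd (fun x => J_AdS *m cayley (frame (normals x))).
  apply: smoothmxM; [exact: oN|exact: smoothmx_cst|].
  apply: smoothmxM; first exact: oN.
    by apply: smoothmxB; [exact: oN|exact: smoothmx_cst|exact: sf].
  apply: smoothmx_inv; first exact: oN.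
    by move=> x [].
  by apply: smoothmxD; [exact: oN|exact: smoothmx_cst|exact: sf].
suff : smooth nbhd (fun x => to_param x 0 l) by apply.
apply: (smooth_ext (f := fun x => if l == 10 :> nat then param (normals x) else
  (J_AdS *m cayley (frame (normals x))) (nth 0 row_index l) (nth 0 col_index l))).
  by move=> x; rewrite [RHS]mxE.
by case: (nat_of_ord l == 10); [exact: smooth_param|exact: sK].
Qed.

Lemma of_param_images r : cayley_dom r ->
  racg_images (fun g => reflection (moved r g)).
Proof.
move=> rD; apply: reflection_images => [g|g h gh]; first exact: q_moved.
by rewrite b_moved // model_comm.
Qed.

Lemma normals_of_param r : param_dom r -> normals (of_param r) = moved r.
Proof.
move=> [rD pos _]; apply/funext => g; rewrite /normals coordsK.
by have [] := normal_reflection (qsign2 g) (q_moved g rD) (pos g).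
Qed.

Lemma of_paramK r : param_dom r -> to_param (of_param r) = r.
Proof.
move=> rW; have [rD _ _] := rW; rewrite /to_param normals_of_param //.
have [-> ->] := frame_equivariant (model (r 0 (inord 10))) (b_moved rD).
rewrite frame_model1 mulmx1 param_model (cayleyK rD).2 mulmxA J_AdSK mul1mx.
exact: skew_mxK.
Qed.

Lemma normals_admissible A : racg_images A -> nbhd (coords A) ->
  [/\ admissible (normals (coords A)),
    forall g, A g = reflection (normals (coords A) g)
  & forall g, 0 < qsign g * b_AdS (normals (coords A) g) (X0 g)].
Proof.
move=> hA [pos units sep _].
have reflA g : [/\ q_AdS (normals (coords A) g) = qsign g,
    A g = reflection (normals (coords A) g)
    & 0 < qsign g * b_AdS (normals (coords A) g) (X0 g)].
  have := units g; have := pos g; rewrite /normals coordsK => pg ug.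
  apply: involution_reflection => //.
  - exact: qsign2.
  - exact: q_model.
  - by have [] := img_isom hA g.
  - exact: img_invol.
split; last first.
- by move=> g; have [] := reflA g.
- by move=> g; have [] := reflA g.
set n := normals (coords A) in reflA sep *; clearbody n.
split=> // [g|g h gh]; first by have [] := reflA g.
have [qg Ag _] := reflA g; have [qh Ah _] := reflA h.
have := img_comm hA gh; rewrite Ag Ah => /reflection_comm_inv.
rewrite qg qh !qsign_neq0 => /(_ isT isT) [//|[c nE]]; exfalso.
have := q_AdSZ c (n h); rewrite -nE qg qh => qc.
have c2 := sqr_ge0 c.
(* Parallel vectors have norms of the same sign, which excludes p with m or l. For m and l, the
   factor c is positive, and [sep_mk] and [sep_lk] contradict each other. *)
case: g h gh nE qc {qg Ag qh Ah} => [e|e|k s] [d|d|k' s'] //= => [_ _|_ _|/eqP <-]; try lra.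
move=> nE _; have m0 := sep_m0 sep e; have l0 := sep_l0 sep k' (e k').
have mk := sep_mk sep e k'; have lk := sep_lk sep k' (e k').
move: m0 mk; rewrite nE !mxE => m0 mk.
have c0 : 0 < c by rewrite -(pmulr_lgt0 _ l0).
by move: mk; rewrite mulrCA ltr_pM2l // => mk; have := lt_trans mk lk; rewrite ltxx.
Qed.

Lemma to_paramK A : racg_images A -> nbhd (coords A) ->
  param_dom (to_param (coords A)) /\ of_param (to_param (coords A)) = coords A.
Proof.
move=> hA nA; have [adm reflA pos] := normals_admissible hA nA.
have fi := frame_isometry adm; have fm := frame_model adm.
have [_ _ _ fu] := nA.
set r := to_param (coords A).
have sk := cayley_skew fi fu.
have [rE yE] := skew_coordsK (param (normals (coords A))) sk.
have [zu zE] := cayleyK fu.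
have ZE : J_AdS *m skew_mx r = cayley (frame (normals (coords A))).
  by rewrite /r rE mulmxA J_AdSK mul1mx.
have rD : cayley_dom r by rewrite /cayley_dom /= ZE.
(* Rigidity enters here: the normals are the image of the model under their frame. *)
have mE g : moved r g = normals (coords A) g.
  by rewrite /moved /rotation ZE zE yE -fm.
have oE : of_param r = coords A.
  congr coords; apply/funext => g; have -> := mE g; exact: (esym (reflA g)).
split; last exact: oE.
by split; [exact: rD|move=> g; rewrite (mE g); exact: pos|rewrite oE; exact: nA].
Qed.

Lemma open_param_dom : open param_dom.
Proof.
have oD := open_cayley_dom.
rewrite openE => r [rD pos rN].
have h1 : \forall s \near r, forall g, 0 < qsign g * b_AdS (moved s g) (X0 g).
  apply: near_forall => g; apply: (near_gt0 _ rD (pos g)).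
  apply: smoothM; [exact: oD|exact: smooth_cst|].
  by apply: smooth_b_AdS; [exact: oD|exact: smooth_moved|exact: smoothmx_cst].
have h2 : \forall s \near r, nbhd (of_param s).
  have co : {for r, continuous of_param} := smooth_of_param 0%N r rD.
  have nb : nbhs (of_param r) nbhd by apply: open_nbhs_nbhs; split; [exact: open_nbhd|].
  exact: (near_preimage co nb).
have h3 := open_near oD rD.
near=> s; split.
- by near: s.
- by near: s.
- by near: s.
Unshelve. all: by end_near. Qed.

End chart.

(** At the base point the normals are the model itself, and all matrices required to be invertible
    equal twice the identity. *)
Lemma nbhd_model (R : realType) (y : R) : y != 0 ->
  nbhd y (coords (fun g => reflection (model y g))).
Proof.
move=> y0.
have pos g : 0 < qsign g * b_AdS (model y g) (model y g).
  by rewrite b_AdSxx q_model qsign2.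
have nE : normals y (coords (fun g => reflection (model y g))) = model y.
  apply/funext => g; rewrite /normals coordsK.
  by have [] := normal_reflection (qsign2 g) (q_model y g) (pos g).
have two : 1%:M + 1%:M \in @unitmx R 5.
  have -> : 1%:M + 1%:M = (2%:M : 'M[R]_5) by rewrite -raddfD.
  by rewrite unitmxE det_scalar unitfE expf_neq0 // pnatr_eq0.
split.
- move=> g; rewrite coordsK.
  by have [] := normal_reflection (qsign2 g) (q_model y g) (pos g).
- by move=> g; rewrite coordsK addrC -addrA (addrC (- _)) addrK.
- by rewrite nE; exact: in_position_model.
- by rewrite nE frame_model1.
Qed.

Lemma submanifold_nbhd (R : realType) (y : R) :
  submanifold 11 (@Hom22 R `&` nbhd y).
Proof.
(* A single chart serves all points x. *)
move=> x Sx; exists (nbhd y), (param_dom y); split.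
- exact: open_nbhd.
- by case: Sx.
- exact: open_param_dom.
rewrite -setIA setIid; exists (to_param y), (@of_param R); split.
- move=> z [_ nz]; exists (nbhd y), (to_param y).
  by split=> //; [exact: open_nbhd|exact: smooth_to_param].
- move=> r [rD _ _]; exists (@cayley_dom R), (@of_param R).
  by split=> //; [exact: open_cayley_dom|exact: smooth_of_param].
- move=> z [/Hom22P[A hA ->] nA].
  exact: (to_paramK hA nA).
- move=> r rW; split; last exact: of_paramK.
  have [rD _ nr] := rW; split=> //.
  apply/Hom22P; eexists; first exact: of_param_images rD.
  by [].
Qed.

Theorem corollary4p12 (R : realType) (t : R) (ht : -1 < t < 1) (ht0 : t != 0) :
  smooth_manifold_near 11 (@Hom22 R) (coords (rho t)).
Proof.
set y := t / Num.sqrt (1 - t ^+ 2).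
have y0 : y != 0.
  have /andP[t1 t2] := ht.
  by rewrite mulf_neq0 // invr_eq0 lt0r_neq0 // sqrtr_gt0; nra.
have -> : coords (rho t) = coords (fun g => reflection (model y g)).
  by congr coords; apply/funext => g; rewrite /rho f_AdS_model.
split.
  apply/Hom22P; exists (fun g => reflection (model y g)) => //.
  by apply: reflection_images; [exact: q_model|exact: model_comm].
exists (nbhd y); split; [exact: open_nbhd|exact: nbhd_model|exact: submanifold_nbhd].
Qed.
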